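(* The edge strong density polyhedron $P_{\mathrm{Edge\text{-}SD}}(G)$ admits a polynomial-time separation oracle: there is a polynomial-time algorithm that, given a graph $G=(V,E)$ and a rational vector $x\in\mathbb{Q}^V$, either certifies that $x\in P_{\mathrm{Edge\text{-}SD}}(G)$ or returns an inequality from the defining system of $P_{\mathrm{Edge\text{-}SD}}(G)$ that is violated by $x$.
   Context: Graphs are finite, undirected, simple and loopless. For $F\subseteq E$, $V(F)$ is the set of vertices incident to at least one edge of $F$, and $d_F(u)$ is the degree of $u$ in $(V(F),F)$. The edge strong density polyhedron is $$P_{\mathrm{Edge\text{-}SD}}(G)=\Big\{x\in[0,1]^V:\ \sum_{u\in V(F)}(d_F(u)-1)x_u\ \ge\ |F|-|V(F)|+1\quad\text{for all } \emptyset\neq F\subseteq E\Big\}.$$ Its defining system consists of the bounds $0\le x_u\le 1$ for $u\in V$ and the displayed inequality for each nonempty $F\subseteq E$. Polynomial time is with respect to the encoding length of $G$ and $x$. *)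

(* Defs.v *)
From mathcomp Require Import all_boot all_order all_algebra.

Set Implicit Arguments.
Unset Strict Implicit.
Unset Printing Implicit Defensive.

Import Order.TTheory GRing.Theory Num.Theory.

Local Open Scope ring_scope.

Section Polyhedron.

Variable V : finType.

(* The edge set of a finite simple graph on [V]: edges are 2-element sets of
   vertices. *)
Definition simple_graph (E : {set {set V}}) : Prop :=
  forall e : {set V}, e \in E -> #|e| = 2%N.

(* V(F) is the union of the edges in F: see [in_verts]. *)
Definition verts (F : {set {set V}}) : {set V} := cover F.

Definition deg (F : {set {set V}}) (u : V) : nat := #|[set e in F | u \in e]|.

Lemma in_verts (F : {set {set V}}) (u : V) :
  (u \in verts F) = [exists e in F, u \in e].
Proof.
apply/bigcupP/exists_inP => [[e eF ue]|[e eF ue]]; by exists e.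
Qed.

Variable R : realFieldType.

(* All differences are taken in [R]: no truncated subtraction. *)
Definition edge_density_ineq (F : {set {set V}}) (x : {ffun V -> R}) : Prop :=
  \sum_(u in verts F) ((deg F u)%:R - 1) * x u
    >= #|F|%:R - #|verts F|%:R + 1.

Definition edge_SD (E : {set {set V}}) (x : {ffun V -> R}) : Prop :=
  (forall u : V, 0 <= x u <= 1) /\
  (forall F : {set {set V}}, F != set0 -> F \subset E -> edge_density_ineq F x).

(* [EdgeDensity F] names the inequality of [F]; it belongs to the system of [E]
   only when [F] is a nonempty subset of [E]. *)
Inductive inequality : Type :=
  | LowerBound of V
  | UpperBound of V
  | EdgeDensity of {set {set V}}.

Definition in_defining_system (E : {set {set V}}) (c : inequality) : Prop :=
  match c with
  | LowerBound _ | UpperBound _ => True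
  | EdgeDensity F => F != set0 /\ F \subset E
  end.

Definition satisfies (x : {ffun V -> R}) (c : inequality) : Prop :=
  match c with
  | LowerBound u => 0 <= x u
  | UpperBound u => x u <= 1
  | EdgeDensity F => edge_density_ineq F x
  end.

(* [None] is the answer "x belongs to the polyhedron". *)
Definition correct_answer (E : {set {set V}}) (x : {ffun V -> R})
    (a : option inequality) : Prop :=
  match a with
  | None => edge_SD E x
  | Some c => in_defining_system E c /\ ~ satisfies x c
  end.

End Polyhedron.

(* Tape symbols: a bit, or [None] for the blank. *)
Notation symbol := (option bool).

Inductive move : Type := MoveLeft | Stay | MoveRight.

(* A two-way infinite tape: the symbols left of the head (nearest first), the
   scanned symbol, the symbols right of the head (nearest first).  Cells beyond
   the ends of the two lists are blank. *)
Record tape : Type := Tape {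
  tape_left : seq symbol;
  tape_head : symbol;
  tape_right : seq symbol }.

Definition write (s : symbol) (t : tape) : tape :=
  Tape (tape_left t) s (tape_right t).

Definition move_head (m : move) (t : tape) : tape :=
  let: Tape l s r := t in
  match m with
  | MoveLeft => Tape (behead l) (head None l) (s :: r)
  | Stay => t
  | MoveRight => Tape (s :: l) (head None r) (behead r)
  end.

(* The head scans the first symbol of [w]. *)
Definition tape_of_word (w : seq bool) : tape :=
  let s := map Some w in Tape [::] (head None s) (behead s).

Fixpoint nonblank_prefix (s : seq symbol) : seq bool :=
  if s is Some b :: s' then b :: nonblank_prefix s' else [::].

(* The word that starts at the head and stops before the first blank. *)
Definition word_of_tape (t : tape) : seq bool :=
  nonblank_prefix (tape_head t :: tape_right t).

(* A machine has [extra_tapes.+1] tapes; the first one holds the input and, at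
   the end, the output. *)
Record turing_machine : Type := TuringMachine {
  extra_tapes : nat;
  state : finType;
  start : state;
  halting : pred state;
  transition : state -> {ffun 'I_extra_tapes.+1 -> symbol} ->
               state * ('I_extra_tapes.+1 -> symbol * move) }.

Section Runs.

Variable M : turing_machine.

Record configuration : Type := Configuration {
  current_state : state M;
  tapes : {ffun 'I_(extra_tapes M).+1 -> tape} }.

Definition initial (w : seq bool) : configuration :=
  Configuration (start M)
    [ffun i => tape_of_word (if i == ord0 then w else [::])].

Definition step (c : configuration) : configuration :=
  let: Configuration q ts := c in
  if halting q then c else
  let: (q', act) := transition q [ffun i => tape_head (ts i)] in
  Configuration q' [ffun i => move_head (act i).2 (write (act i).1 (ts i))].

(* Started on [w], the machine halts after at most [T] steps with output [w']. *)
Definition computes_within (T : nat) (w w' : seq bool) : Prop :=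
  exists2 t : nat, (t <= T)%N &
    let c := iter t step (initial w) in
    halting (current_state c) /\ word_of_tape (tapes c ord0) = w'.

End Runs.

(* Structured data are represented as binary trees, written as words in
   preorder. *)
Inductive tree : Type := Leaf | Node of tree & tree.

Fixpoint preorder (t : tree) : seq bool :=
  match t with
  | Leaf => [:: false]
  | Node l r => true :: preorder l ++ preorder r
  end.

Definition tree_of_bool (b : bool) : tree := if b then Node Leaf Leaf else Leaf.

Definition tree_of_seq (T : Type) (f : T -> tree) (s : seq T) : tree :=
  foldr (fun a t => Node (f a) t) Leaf s.

Fixpoint bits_of_pos (p : BinNums.positive) : seq bool :=
  match p with
  | BinNums.xH => [:: true]
  | BinNums.xO q => false :: bits_of_pos q
  | BinNums.xI q => true :: bits_of_pos q
  end.

(* Binary expansion, least significant bit first; 0 has the empty expansion. *)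
Definition bits_of_nat (n : nat) : seq bool :=
  if bin_of_nat n is BinNums.Npos p then bits_of_pos p else [::].

Definition tree_of_nat (n : nat) : tree := tree_of_seq tree_of_bool (bits_of_nat n).

Definition tree_of_int (z : int) : tree :=
  Node (tree_of_bool (z < 0)) (tree_of_nat `|z|%N).

(* [numq] and [denq] are coprime and [denq] is positive. *)
Definition tree_of_rat (q : rat) : tree :=
  Node (tree_of_int (numq q)) (tree_of_nat `|denq q|%N).

(* A set of edges is represented by its adjacency matrix, row by row.  The
   diagonal is 0 because [set i; i] has one element.  This determines the set
   among those whose members are 2-element sets. *)
Definition tree_of_edges (n : nat) (E : {set {set 'I_n}}) : tree :=
  tree_of_seq
    (fun i : 'I_n =>
       tree_of_seq (fun j : 'I_n => tree_of_bool ([set i; j] \in E)) (enum 'I_n))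
    (enum 'I_n).

Definition tree_of_vector (n : nat) (x : {ffun 'I_n -> rat}) : tree :=
  tree_of_seq (fun i : 'I_n => tree_of_rat (x i)) (enum 'I_n).

Definition encode_instance (n : nat) (E : {set {set 'I_n}})
    (x : {ffun 'I_n -> rat}) : seq bool :=
  preorder (Node (tree_of_edges E) (tree_of_vector x)).

Definition encode_answer (n : nat) (a : option (inequality 'I_n)) : seq bool :=
  preorder
    match a with
    | None => Leaf
    | Some (LowerBound u) => Node (tree_of_nat 0) (tree_of_nat u)
    | Some (UpperBound u) => Node (tree_of_nat 1) (tree_of_nat u)
    | Some (EdgeDensity F) => Node (tree_of_nat 2) (tree_of_edges F)
    end.

(* Main.v *)
Require Import Defs.
From mathcomp Require Import all_boot all_order all_algebra.
From mathcomp Require Import zify ring lra.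

Set Implicit Arguments.
Unset Strict Implicit.
Unset Printing Implicit Defensive.

(** Write w = 1 - x.  The inequality of F then reads
      1 + sum_(e in F) (w(e) - 1) <= w(V(F)),   where w(uv) = w(u) + w(v),
    and it holds with equality when F is a single edge.  So fix an edge e0 of F.
    Some F containing e0 is violated if and only if the demands max(0, w(e) - 1)
    of the edges e other than e0 cannot be split between their ends without
    exceeding the capacity w(u) of some vertex u, the ends of e0 having
    capacity 0.  After multiplication by all denominators this is an integral
    flow problem, solved by bit scaling: a solution for the halved data (demands
    rounded down, capacities rounded up) is doubled, which leaves a total excess
    of at most n (n + 1), and every augmenting path removes one unit of it.  If
    overloaded vertices remain and no augmenting path exists, the vertices that
    cannot reach spare capacity form a violating set, also for the original data.

    Polynomial time is not proved on Turing machines but on functions.  Programs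
    over four stacks of bits compile to Turing machines step for step, and the
    functions on tree-coded data that such programs compute in polynomial time
    are closed under composition, pairing, case distinction, and folds whose
    accumulator stays of polynomial size. *)

(** * Structured programs over four stacks of bits *)

(** If e0 lies in F, its own term and the constant 1 add up to w(e0), which is exactly what the two
    ends of e0 contribute to w(V(F)). Cancelling leaves the condition that the demands of the other
    edges of F are at most the capacity of V(F), the ends of e0 being free. By a Hall-type argument,
    this holds for all such F if and only if the demands can be split, so one flow problem per edge
    suffices. Scaling is needed because the common denominator may be exponentially large, so that
    removing an initial excess unit by unit would take too long. The directions of rounding make the
    coarse problem the easier one: a set that violates it also violates the finer one. Size bounds
    are required for every value of the input type, not only for codes of graphs. Hence the
    algorithm has no loop with a stopping test: every loop is a fold over a list of known length,
    and every table is capped by a fixed one, so that its size is bounded without appeal to any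
    invariant of the flow. *)

Inductive reg := RA | RB | RC | RK.

(** Data are processed on [stA]; [stB] and [stC] are scratch stacks, and [stK] is the counter of the
    tree parser. *)
Record store := Store { stA : seq bool; stB : seq bool; stC : seq bool; stK : seq bool }.

Definition get (r : reg) (s : store) : seq bool :=
  match r with RA => stA s | RB => stB s | RC => stC s | RK => stK s end.

Definition set (r : reg) (v : seq bool) (s : store) : store :=
  let: Store a b c k := s in
  match r with
  | RA => Store v b c k | RB => Store a v c k
  | RC => Store a b v k | RK => Store a b c v
  end.

Inductive cmd :=
  | Skip
  | Push of reg & bool
  | Pop of reg
  | Seq of cmd & cmd
  | If of reg & cmd & cmd
  | While of reg & cmd.

Definition top (r : reg) (s : store) : bool := head false (get r s).

(* The last argument is the exact number of steps of the compiled machine. *)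
Inductive run : cmd -> store -> store -> nat -> Prop :=
  | run_skip s : run Skip s s 0
  | run_push r b s : run (Push r b) s (set r (b :: get r s) s) 2
  | run_pop r s : run (Pop r) s (set r (behead (get r s)) s) 1
  | run_seq c1 c2 s1 s2 s3 t1 t2 :
      run c1 s1 s2 t1 -> run c2 s2 s3 t2 -> run (Seq c1 c2) s1 s3 (t1 + t2)
  | run_if_true r c1 c2 s s' t :
      top r s -> run c1 s s' t -> run (If r c1 c2) s s' t.+2
  | run_if_false r c1 c2 s s' t :
      ~~ top r s -> run c2 s s' t -> run (If r c1 c2) s s' t.+1
  | run_while_end r c s : ~~ top r s -> run (While r c) s s 1
  | run_while_step r c s1 s2 s3 t1 t2 :
      top r s1 -> run c s1 s2 t1 -> run (While r c) s2 s3 t2 ->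
      run (While r c) s1 s3 (t1 + t2).+2.

(** * Compilation to Turing machines *)

Inductive instr :=
  | Act of reg & option bool & move
  | Branch of reg & nat
  | Jump of nat.

Fixpoint code_size (c : cmd) : nat :=
  match c with
  | Skip => 0
  | Push _ _ => 2
  | Pop _ => 1
  | Seq c1 c2 => code_size c1 + code_size c2
  | If _ c1 c2 => (code_size c1 + (code_size c2).+1).+1
  | While _ c => (code_size c).+2
  end.

(** [o] is the address at which the code will be placed; jump targets are absolute. *)
Fixpoint compile (o : nat) (c : cmd) : seq instr :=
  match c with
  | Skip => [::]
  | Push r b => [:: Act r None MoveLeft; Act r (Some b) Stay]
  | Pop r => [:: Act r None MoveRight]
  | Seq c1 c2 => compile o c1 ++ compile (o + code_size c1) c2
  | If r c1 c2 =>
      Branch r (o + code_size c1).+2 ::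
      compile o.+1 c1 ++
      Jump (o + code_size (If r c1 c2)) :: compile (o + code_size c1).+2 c2
  | While r c =>
      Branch r (o + (code_size c).+2) :: compile o.+1 c ++ [:: Jump o]
  end.

Lemma size_compile o c : size (compile o c) = code_size c.
Proof.
elim: c o => [|r b|r|c1 IH1 c2 IH2|r c1 IH1 c2 IH2|r c IH] o //=;
  by rewrite ?size_cat /= ?IH1 ?IH2 ?IH ?addn1.
Qed.

Definition reg_index (r : reg) : 'I_4 :=
  match r with
  | RA => ord0 | RB => @Ordinal 4 1 isT | RC => @Ordinal 4 2 isT
  | RK => @Ordinal 4 3 isT
  end.

Lemma get_set r r' v s :
  get r' (set r v s) = if reg_index r' == reg_index r then v else get r' s.
Proof. by case: s => ????; case: r; case: r'. Qed.

Lemma reg_index_inj : injective reg_index.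
Proof. by case; case. Qed.

Arguments step : simpl never.

Section Machine.

Variable P : seq instr.

(** The state is the program counter. The address [size P], just behind the program, is the only
    halting state. A blank is not [Some true], so branching on an empty stack behaves as on
    [false]. *)
Definition machine_transition (q : 'I_(size P).+1)
    (h : {ffun 'I_4 -> symbol}) : 'I_(size P).+1 * ('I_4 -> symbol * move) :=
  match nth (Jump (size P)) P q with
  | Act r w m =>
      (inord q.+1, fun i => if i == reg_index r
                            then (if w is Some b then Some b else h i, m)
                            else (h i, Stay))
  | Branch r l =>
      (inord (if h (reg_index r) == Some true then q.+1 else l),
       fun i => (h i, Stay))
  | Jump l => (inord l, fun i => (h i, Stay))
  end.

Definition machine : turing_machine :=
  @TuringMachine 3 _ ord0 (fun q : 'I_(size P).+1 => q == ord_max)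
    machine_transition.

(* The head is on the top of the stack; what lies to its left is irrelevant. *)
Definition holds (t : tape) (s : seq bool) : Prop :=
  exists k, tape_head t :: tape_right t = map Some s ++ nseq k None.

Definition at_point (pc : nat) (s : store) (c : configuration machine) : Prop :=
  nat_of_ord (current_state c : 'I_(size P).+1) = pc /\
  forall r, holds (tapes c (reg_index r)) (get r s).

(** The bound makes every address in the code, and the one just behind it, a valid state. *)
Definition code_at (o : nat) (code : seq instr) : Prop :=
  o + size code <= size P /\
  forall i, i < size code ->
    nth (Jump (size P)) P (o + i) = nth (Jump (size P)) code i.

Lemma code_at_cat o c1 c2 :
  code_at o (c1 ++ c2) -> code_at o c1 /\ code_at (o + size c1) c2.
Proof.
case; rewrite size_cat => le_s eq_n; split; split.
- by lia.
- by move=> i lt_i; rewrite eq_n ?nth_cat ?lt_i //; lia.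
- by lia.
- move=> i lt_i; rewrite -addnA eq_n; last by lia.
  by rewrite nth_cat ltnNge leq_addr /= addKn.
Qed.

Lemma code_at_cons o a c :
  code_at o (a :: c) ->
  [/\ o < size P, nth (Jump (size P)) P o = a & code_at o.+1 c].
Proof.
move=> h; have [[/= le1 /(_ 0 isT) /=]] := @code_at_cat o [:: a] c h.
rewrite addn0 addn1 => eq_a h2; split => //; by move: le1; rewrite addn1.
Qed.

Lemma holds_head t s : holds t s -> (tape_head t == Some true) = head false s.
Proof.
case: t => l h r [k] /=; case: s => [|b s] /=.
  by case: k => [|k] //= [-> _].
by case=> -> _; case: b.
Qed.

Lemma holds_stay t s : holds t s -> holds (move_head Stay (write (tape_head t) t)) s.
Proof. by case: t. Qed.

Lemma holds_push t b s :
  holds t s ->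
  let t' := move_head MoveLeft (write (tape_head t) t) in
  holds (move_head Stay (write (Some b) t')) (b :: s).
Proof. by case: t => l h r [k] /= ->; exists k. Qed.

Lemma holds_pop t s :
  holds t s -> holds (move_head MoveRight (write (tape_head t) t)) (behead s).
Proof.
case: t => l h r [k] /=; case: s => [|b s] /=.
  by case: k => [|k] //= [_ ->]; case: k => [|k]; [exists 1|exists k.+1].
case=> _ ->; case: s => [|b' s] /=; last by exists k.
by case: k => [|k]; [exists 1 | exists k.+1].
Qed.

Lemma step_jump pc s c l :
  pc < size P -> nth (Jump (size P)) P pc = Jump l -> l <= size P ->
  at_point pc s c -> at_point l s (step c).
Proof.
case: c => q ts lt_pc eq_i le_l [/= eq_q h]; rewrite /step /=.
have -> : (q == ord_max :> 'I_(size P).+1) = false.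
  by apply/negbTE/eqP => /(congr1 val) /=; rewrite eq_q; lia.
rewrite /machine_transition eq_q eq_i; split=> [|r] /=; first by rewrite inordK.
by rewrite !ffunE; apply: holds_stay.
Qed.

Lemma step_branch pc s c r l :
  pc < size P -> nth (Jump (size P)) P pc = Branch r l -> l <= size P ->
  at_point pc s c -> at_point (if top r s then pc.+1 else l) s (step c).
Proof.
case: c => q ts lt_pc eq_i le_l [/= eq_q h]; rewrite /step /=.
have -> : (q == ord_max :> 'I_(size P).+1) = false.
  by apply/negbTE/eqP => /(congr1 val) /=; rewrite eq_q; lia.
rewrite /machine_transition eq_q eq_i; split=> [|r'] /=.
  by rewrite ffunE (holds_head (h r)) inordK // /top; case: ifP; lia.
by rewrite !ffunE; apply: holds_stay.
Qed.

Lemma step_act pc q ts r w m :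
  pc < size P -> nth (Jump (size P)) P pc = Act r w m ->
  nat_of_ord (q : 'I_(size P).+1) = pc ->
  let c := step (@Configuration machine q ts) in
  nat_of_ord (current_state c : 'I_(size P).+1) = pc.+1 /\
  forall r', tapes c (reg_index r') =
    let t := ts (reg_index r') in
    if reg_index r' == reg_index r
    then move_head m (write (if w is Some b then Some b else tape_head t) t)
    else move_head Stay (write (tape_head t) t).
Proof.
move=> lt_pc eq_i eq_q; rewrite /step /=.
have -> : (q == ord_max :> 'I_(size P).+1) = false.
  by apply/negbTE/eqP => /(congr1 val) /=; rewrite eq_q; lia.
rewrite /machine_transition eq_q eq_i; split=> [|r'] /=.
  by rewrite inordK.
by rewrite !ffunE; case: ifP => _ //=; case: w {eq_i}.
Qed.

Lemma step_push pc s c r b :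
  code_at pc (compile pc (Push r b)) -> at_point pc s c ->
  at_point pc.+2 (set r (b :: get r s) s) (step (step c)).
Proof.
move=> /code_at_cons [lt1 eq1 /code_at_cons [lt2 eq2 _]].
case: c => q ts [/= eq_q h].
have [] := step_act ts lt1 eq1 eq_q; case: (step _) => q1 ts1 /= eq_q1 eq_t1.
have [] := step_act ts1 lt2 eq2 eq_q1; case: (step _) => q2 ts2 /= eq_q2 eq_t2.
split=> //= r'; rewrite eq_t2 get_set.
have := h r'; rewrite !eq_t1 /=; case: eqP => [/reg_index_inj -> | _].
  exact: holds_push.
by move=> hr; do 2!apply: holds_stay.
Qed.

Lemma step_pop pc s c r :
  code_at pc (compile pc (Pop r)) -> at_point pc s c ->
  at_point pc.+1 (set r (behead (get r s)) s) (step c).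
Proof.
move=> /code_at_cons [lt1 eq1 _].
case: c => q ts [/= eq_q h].
have [] := step_act ts lt1 eq1 eq_q; case: (step _) => q1 ts1 /= eq_q1 eq_t1.
split=> //= r'; rewrite get_set eq_t1 /=.
have := h r'; case: eqP => [/reg_index_inj -> | _]; [exact: holds_pop | exact: holds_stay].
Qed.

Lemma run_machine c s s' t :
  run c s s' t ->
  forall o cf, code_at o (compile o c) -> at_point o s cf ->
    at_point (o + code_size c) s' (iter t (@step machine) cf).
Proof.
elim=> {c s s' t} [s|r b s|r s|c1 c2 s1 s2 s3 t1 t2 _ IH1 _ IH2
  |r c1 c2 s s' t tp _ IH|r c1 c2 s s' t tp _ IH|r c s tp
  |r c s1 s2 s3 t1 t2 tp _ IH1 _ IH2] o cf.
- by rewrite addn0.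
- by move=> h1 h2; have := step_push h1 h2; rewrite addn2.
- by move=> h1 h2; have := step_pop h1 h2; rewrite addn1.
- move=> /= /code_at_cat; rewrite size_compile => -[h1 h2] /(IH1 _ _ h1) /(IH2 _ _ h2).
  by rewrite [t1 + _]addnC iterD addnA.
- move=> /code_at_cons [lt1 eq1 /code_at_cat []]; rewrite size_compile => h1.
  move=> /code_at_cons [lt2 eq2 [le3 _]] /(step_branch lt1 eq1).
  rewrite size_compile in le3; rewrite tp => /(_ ltac:(lia)) /(IH _ _ h1).
  rewrite iterS iterSr => /(step_jump _ eq2); apply => //=; by lia.
- move=> /code_at_cons [lt1 eq1 /code_at_cat []]; rewrite size_compile => h1.
  move=> /code_at_cons [lt2 eq2 h2] /(step_branch lt1 eq1).
  have le4 : (o + code_size c1).+2 <= size P by case: h2 => + _; lia.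
  rewrite (negbTE tp) iterSr => /(_ le4) /(IH _ _ h2).
  by congr at_point => /=; lia.
- move=> /code_at_cons [lt1 eq1 /code_at_cat [_ [/= le3 _]]] /(step_branch lt1 eq1).
  rewrite size_compile in le3.
  by rewrite (negbTE tp) => h3; apply: h3; lia.
(* The closing jump returns to [o], so [hc] serves again for the remaining iterations. *)
- move=> hc at1; have := hc.
  move=> /code_at_cons [lt1 eq1 /code_at_cat []]; rewrite size_compile => h1.
  move=> /code_at_cons [lt2 eq2 _].
  have le_o : o + (code_size c).+2 <= size P by lia.
  have := step_branch lt1 eq1 le_o at1; rewrite tp => /(IH1 _ _ h1).
  move=> /(step_jump lt2 eq2 (ltnW lt1)) /(IH2 _ _ hc).
  by rewrite -iterS -iterSr -iterD; congr at_point; congr iter; lia.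
Qed.

End Machine.

Lemma compiled_computes c w w' t s' :
  run c (Store w [::] [::] [::]) s' t -> stA s' = w' ->
  forall T, t <= T -> computes_within (machine (compile 0 c)) T w w'.
Proof.
move=> r eq_w T le_t; exists t => //.
set cf := initial _ _.
have h0 : at_point 0 (Store w [::] [::] [::]) cf.
  split=> // r'; rewrite ffunE.
  case: r' => /=; try by exists 1.
  by case: (w) => [|b v]; [exists 1 | exists 0; rewrite cats0].
have [|eq_q /(_ RA) [k eq_t]] := run_machine r _ h0; first by split.
split; first by apply/eqP/val_inj; apply: (etrans eq_q); rewrite /= size_compile.
rewrite /word_of_tape [_ :: _]eq_t -eq_w /=.
by elim: (stA s') => [|b v /= ->] //; case: k {eq_t}.
Qed.

(** * Running times *)

Definition runs (c : cmd) (s s' : store) (T : nat) : Prop :=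
  exists2 t, t <= T & run c s s' t.

Lemma runs_le c s s' T T' : runs c s s' T -> T <= T' -> runs c s s' T'.
Proof. by case=> t le_t r le_T; exists t => //; apply: leq_trans le_T. Qed.

Lemma runs_skip s : runs Skip s s 0.
Proof. by exists 0 => //; constructor. Qed.

Lemma runs_push r b s : runs (Push r b) s (set r (b :: get r s) s) 2.
Proof. by exists 2 => //; constructor. Qed.

Lemma runs_pop r s : runs (Pop r) s (set r (behead (get r s)) s) 1.
Proof. by exists 1 => //; constructor. Qed.

Lemma runs_seq c1 c2 s1 s2 s3 T1 T2 :
  runs c1 s1 s2 T1 -> runs c2 s2 s3 T2 -> runs (Seq c1 c2) s1 s3 (T1 + T2).
Proof.
case=> t1 le1 r1 [t2 le2 r2]; exists (t1 + t2); first exact: leq_add.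
by apply: run_seq r1 r2.
Qed.

Lemma runs_if r c1 c2 s s' T :
  runs (if top r s then c1 else c2) s s' T -> runs (If r c1 c2) s s' (T + 2).
Proof.
case: (boolP (top r s)) => tp [t le_t rt].
  by exists t.+2; [lia | constructor].
by exists t.+1; [lia | constructor].
Qed.

Lemma runs_while_end r c s : ~~ top r s -> runs (While r c) s s 1.
Proof. by exists 1 => //; constructor. Qed.

Lemma runs_while r c s1 s2 s3 T1 T2 :
  top r s1 -> runs c s1 s2 T1 -> runs (While r c) s2 s3 T2 ->
  runs (While r c) s1 s3 (T1 + T2 + 2).
Proof.
move=> tp [t1 le1 r1] [t2 le2 r2]; exists (t1 + t2).+2; first lia.
exact: run_while_step r1 r2.
Qed.

Definition store_size (s : store) : nat :=
  size (stA s) + size (stB s) + size (stC s) + size (stK s).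

(** At most one bit is added per step, so running time bounds the size of results; [ptime_sz] rests
    on this. *)
Lemma run_store_size c s s' t : run c s s' t -> store_size s' <= store_size s + t.
Proof.
elim=> {c s s' t}; rewrite /store_size; try by intros; lia.
- by move=> r b [a b' c k]; case: r => /=; lia.
- by move=> r [a b' c k]; case: r => /=; rewrite size_behead; lia.
Qed.

(** * Trees as self-delimiting words *)

Local Notation "c1 ;; c2" := (Seq c1 c2) (at level 55, right associativity).

Section Parse.

Variable act : bool -> cmd.

(* The stack [RK] holds, in unary, the number of trees still to be read. *)
Definition parse_loop : cmd :=
  While RK
    (Pop RK ;;
     If RA (Pop RA ;; act true ;; Push RK true ;; Push RK true)
           (Pop RA ;; act false)).

(** The [false] below the unary counter ends the loop whatever lies deeper on [RK]. *)
Definition parse : cmd := Push RK false ;; Push RK true ;; parse_loop ;; Pop RK.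

Variables (gB gC : bool -> seq bool -> seq bool) (ta : nat).

Hypothesis act_runs : forall b a B C K,
  runs (act b) (Store a B C K) (Store a (gB b B) (gC b C) K) ta.

Let pass (g : bool -> seq bool -> seq bool) (w s : seq bool) : seq bool :=
  foldl (fun s b => g b s) s w.

(** The rest of the loop is a hypothesis, so that the induction composes: reading a node replaces
    one pending tree by two, and each of them is consumed by an induction hypothesis. *)
Lemma runs_parse_loop t A B C K s T :
  runs parse_loop (Store A (pass gB (preorder t) B) (pass gC (preorder t) C) K) s T ->
  runs parse_loop (Store (preorder t ++ A) B C (true :: K)) s
    (T + (ta + 20) * size (preorder t)).
Proof.
elim: t A B C K T => [|l IHl r IHr] A B C K T /= h.
  apply: (@runs_le _ _ _ ((1 + (1 + ta + 2)) + T + 2)); last by lia.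
  apply: runs_while h => //; apply: runs_seq (runs_pop _ _) _; apply: runs_if => /=.
  by apply: runs_seq (runs_pop _ _) _; apply: act_runs.
rewrite /pass /= !foldl_cat in h.
move: h => /IHr /IHl; rewrite catA => h; rewrite size_cat.
apply: (@runs_le _ _ _ ((1 + (1 + (ta + (2 + 2)) + 2)) + (T + (ta + 20) * size (preorder r) +
  (ta + 20) * size (preorder l)) + 2)); last by lia.
apply: runs_while h => //; apply: runs_seq (runs_pop _ _) _; apply: runs_if => /=.
apply: runs_seq (runs_pop _ _) _; apply: runs_seq (act_runs _ _ _ _ _) _.
by apply: runs_seq (runs_push _ _ _) _; apply: runs_push.
Qed.

Lemma runs_parse t A B C K :
  runs parse (Store (preorder t ++ A) B C K)
    (Store A (pass gB (preorder t) B) (pass gC (preorder t) C) K)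
    ((ta + 20) * size (preorder t) + 6).
Proof.
apply: (@runs_le _ _ _ (2 + (2 + ((1 + (ta + 20) * size (preorder t)) + 1)))); last by lia.
apply: runs_seq (runs_push _ _ _) _; apply: runs_seq (runs_push _ _ _) _.
apply: runs_seq; first by apply: runs_parse_loop; apply: runs_while_end.
exact: runs_pop.
Qed.

End Parse.

(* On [RB] and [RC] a word is stored backwards, each bit below a mark [true],
   above a mark [false]: this makes it self-delimiting again. *)
Definition chunk (t : tree) (s : seq bool) : seq bool :=
  foldl (fun s b => true :: b :: s) (false :: s) (preorder t).

Definition mark (r : reg) (b : bool) : cmd := Push r b ;; Push r true.

Definition save (r : reg) : cmd := Push r false ;; parse (mark r).

Definition save_twice : cmd :=
  Push RB false ;; Push RC false ;; parse (fun b => mark RB b ;; mark RC b).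

Definition drop_tree : cmd := parse (fun _ => Skip).

Definition restore (r : reg) : cmd :=
  While r (Pop r ;; If r (Pop r ;; Push RA true) (Pop r ;; Push RA false)) ;; Pop r.

Definition dup : cmd := save_twice ;; restore RB ;; restore RC.

Definition swap : cmd := save RB ;; save RC ;; restore RB ;; restore RC.

Lemma runs_saveB t A B C K :
  runs (save RB) (Store (preorder t ++ A) B C K) (Store A (chunk t B) C K)
    (40 * size (preorder t) + 40).
Proof.
have nop s : foldl (fun s b => s) s (preorder t) = s by elim: (preorder t).
have act b a B' C' K' :
  runs (mark RB b) (Store a B' C' K') (Store a (true :: b :: B') C' K') (2 + 2).
  by apply: runs_seq (runs_push _ _ _) _; apply: runs_push.
apply: runs_le; first apply: runs_seq (runs_push _ _ _) _.
  by have := runs_parse act t A (false :: B) C K; rewrite nop; apply.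
by lia.
Qed.

Lemma runs_saveC t A B C K :
  runs (save RC) (Store (preorder t ++ A) B C K) (Store A B (chunk t C) K)
    (40 * size (preorder t) + 40).
Proof.
have nop s : foldl (fun s b => s) s (preorder t) = s by elim: (preorder t).
have act b a B' C' K' :
  runs (mark RC b) (Store a B' C' K') (Store a B' (true :: b :: C') K') (2 + 2).
  by apply: runs_seq (runs_push _ _ _) _; apply: runs_push.
apply: runs_le; first apply: runs_seq (runs_push _ _ _) _.
  by have := runs_parse act t A B (false :: C) K; rewrite nop; apply.
by lia.
Qed.

Lemma runs_save_twice t A B C K :
  runs save_twice (Store (preorder t ++ A) B C K) (Store A (chunk t B) (chunk t C) K)
    (40 * size (preorder t) + 40).
Proof.
have act b a B' C' K' :
  runs (mark RB b ;; mark RC b) (Store a B' C' K')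
    (Store a (true :: b :: B') (true :: b :: C') K') ((2 + 2) + (2 + 2)).
  by apply: runs_seq; apply: runs_seq (runs_push _ _ _) _; apply: runs_push.
apply: runs_le; first apply: runs_seq (runs_push _ _ _) _.
  apply: runs_seq (runs_push _ _ _) _.
  exact: runs_parse act t A (false :: B) (false :: C) K.
by lia.
Qed.

Lemma runs_drop t A B C K :
  runs drop_tree (Store (preorder t ++ A) B C K) (Store A B C K)
    (40 * size (preorder t) + 40).
Proof.
have nop s : foldl (fun s b => s) s (preorder t) = s by elim: (preorder t).
have act (b : bool) a B' C' K' : runs Skip (Store a B' C' K') (Store a B' C' K') 0.
  exact: runs_skip.
have := runs_parse act t A B C K; rewrite !nop => /runs_le; apply.
by lia.
Qed.

Lemma runs_restoreB t A B C K :
  runs (restore RB) (Store A (chunk t B) C K) (Store (preorder t ++ A) B C K)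
    (40 * size (preorder t) + 40).
Proof.
apply: (@runs_le _ _ _ (10 * size (preorder t) + 1 + 1)); last by lia.
apply: (@runs_seq _ _ _ (Store (preorder t ++ A) (false :: B) C K)); last exact: runs_pop.
(* The last bit of the word is on top of the stack, hence induction from the end. *)
rewrite /chunk; elim/last_ind: (preorder t) A => [|w b IH] A.
  exact: runs_while_end.
rewrite foldl_rcons size_rcons cat_rcons.
apply: (@runs_le _ _ _ (1 + (1 + 2 + 2) + (10 * size w + 1) + 2)); last by lia.
apply: runs_while (IH _) => //; apply: runs_seq (runs_pop _ _) _; apply: runs_if => /=.
by case: b => /=; apply: runs_seq (runs_pop _ _) _; apply: runs_push.
Qed.

Lemma runs_restoreC t A B C K :
  runs (restore RC) (Store A B (chunk t C) K) (Store (preorder t ++ A) B C K)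
    (40 * size (preorder t) + 40).
Proof.
apply: (@runs_le _ _ _ (10 * size (preorder t) + 1 + 1)); last by lia.
apply: (@runs_seq _ _ _ (Store (preorder t ++ A) B (false :: C) K)); last exact: runs_pop.
rewrite /chunk; elim/last_ind: (preorder t) A => [|w b IH] A.
  exact: runs_while_end.
rewrite foldl_rcons size_rcons cat_rcons.
apply: (@runs_le _ _ _ (1 + (1 + 2 + 2) + (10 * size w + 1) + 2)); last by lia.
apply: runs_while (IH _) => //; apply: runs_seq (runs_pop _ _) _; apply: runs_if => /=.
by case: b => /=; apply: runs_seq (runs_pop _ _) _; apply: runs_push.
Qed.

Lemma runs_dup t A B C K :
  runs dup (Store (preorder t ++ A) B C K)
    (Store (preorder t ++ preorder t ++ A) B C K) (120 * size (preorder t) + 120).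
Proof.
apply: runs_le; first apply: runs_seq (runs_save_twice _ _ _ _ _) _.
  by apply: runs_seq (runs_restoreB _ _ _ _ _) _; apply: runs_restoreC.
by lia.
Qed.

Lemma runs_swap t u A B C K :
  runs swap (Store (preorder t ++ preorder u ++ A) B C K)
    (Store (preorder u ++ preorder t ++ A) B C K)
    (80 * (size (preorder t) + size (preorder u)) + 160).
Proof.
apply: runs_le; first apply: runs_seq (runs_saveB _ _ _ _ _) _.
  apply: runs_seq (runs_saveC _ _ _ _ _) _.
  by apply: runs_seq (runs_restoreB _ _ _ _ _) _; apply: runs_restoreC.
by lia.
Qed.

(** * Polynomial-time functions *)

Class coded (T : Type) := code : T -> tree.

#[global] Instance coded_tree : coded tree := id.
#[global] Instance coded_bool : coded bool := tree_of_bool.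
#[global] Instance coded_nat : coded nat := tree_of_nat.
#[global] Instance coded_prod A B (cA : coded A) (cB : coded B) : coded (A * B) :=
  fun p => Node (code p.1) (code p.2).
#[global] Instance coded_seq A (cA : coded A) : coded (seq A) := tree_of_seq code.

Definition word T {cT : coded T} (a : T) : seq bool := preorder (code a).
Definition sz T {cT : coded T} (a : T) : nat := size (word a).

(** The base is at least 2, so constants and sums are absorbed by a larger exponent. *)
Definition pbounded T {cT : coded T} (g : T -> nat) : Prop :=
  exists k, forall a, g a <= (sz a + 2) ^ k.

(** The argument is replaced in place on top of [RA] and all else is preserved. This frame condition
    allows programs to be combined while other data wait deeper on the stacks. *)
Definition ptime S T {cS : coded S} {cT : coded T} (f : S -> T) : Prop :=
  exists c : cmd, exists2 g : S -> nat, pbounded g &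
    forall a A B C K,
      runs c (Store (word a ++ A) B C K) (Store (word (f a) ++ A) B C K) (g a).

Section PBounded.

Context {S : Type} {cS : coded S}.

Lemma pbounded_le (g h : S -> nat) :
  pbounded h -> (forall a, g a <= h a) -> pbounded g.
Proof. by case=> k hk le_gh; exists k => a; apply: leq_trans (hk a). Qed.

Lemma pbounded_const n : pbounded (fun _ : S => n).
Proof.
exists n => a; apply: leq_trans (ltnW (ltn_expl n (ltnSn 1))) _.
by case: n => // n; rewrite leq_exp2r //; lia.
Qed.

Lemma pbounded_sz : pbounded (fun a : S => sz a).
Proof. by exists 1 => a; rewrite expn1; lia. Qed.

Lemma pbounded_add (g h : S -> nat) :
  pbounded g -> pbounded h -> pbounded (fun a => g a + h a).
Proof.
case=> k hk [l hl]; exists (k + l).+1 => a; rewrite expnS.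
have le1 : (sz a + 2) ^ k <= (sz a + 2) ^ (k + l) by rewrite leq_pexp2l //; lia.
have le2 : (sz a + 2) ^ l <= (sz a + 2) ^ (k + l) by rewrite leq_pexp2l //; lia.
have := hk a; have := hl a; nia.
Qed.

Lemma pbounded_mul (g h : S -> nat) :
  pbounded g -> pbounded h -> pbounded (fun a => g a * h a).
Proof.
by case=> k hk [l hl]; exists (k + l) => a; rewrite expnD; apply: leq_mul.
Qed.

Lemma pbounded_comp T (cT : coded T) (f : S -> T) (g : T -> nat) :
  pbounded g -> pbounded (fun a => sz (f a)) -> pbounded (fun a => g (f a)).
Proof.
(* The shift by 2 is absorbed by X^l + 2 <= X^(l + 2) for X >= 2. *)
case=> k hk [l hl]; exists ((l + 2) * k) => a.
apply: leq_trans (hk _) _; rewrite expnM.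
case: k {hk} => // k; rewrite leq_exp2r // expnD.
have := hl a; have : 0 < (sz a + 2) ^ l by rewrite expn_gt0; lia.
have : 4 <= (sz a + 2) ^ 2 by rewrite (@leq_exp2r 2 _ 2) //; lia.
nia.
Qed.

End PBounded.

Lemma sz_gt0 T {cT : coded T} (a : T) : 0 < sz a.
Proof. by rewrite /sz /word; case: (code a). Qed.

Lemma word_pair S T {cS : coded S} {cT : coded T} (a : S) (b : T) :
  word (a, b) = true :: word a ++ word b.
Proof. by []. Qed.

Lemma sz_pair S T {cS : coded S} {cT : coded T} (a : S) (b : T) :
  sz (a, b) = (sz a + sz b).+1.
Proof. by rewrite /sz word_pair /= size_cat. Qed.

Lemma word_cons T {cT : coded T} (a : T) (l : seq T) :
  word (a :: l) = true :: word a ++ word l.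
Proof. by []. Qed.

Lemma sz_cons T {cT : coded T} (a : T) (l : seq T) : sz (a :: l) = (sz a + sz l).+1.
Proof. by rewrite /sz word_cons /= size_cat. Qed.

Lemma sz_cat T {cT : coded T} (l m : seq T) : (sz (l ++ m)).+1 = sz l + sz m.
Proof. by elim: l => [|a l IH]; rewrite ?cat_cons ?sz_cons ?add1n //; lia. Qed.

Lemma size_le_sz T {cT : coded T} (l : seq T) : size l < sz l.
Proof.
elim: l => // a l; rewrite sz_cons /=; have := sz_gt0 a.
by lia.
Qed.

Ltac pb :=
  lazymatch goal with
  | |- pbounded (fun x => @?f x + @?g x) => apply: (@pbounded_add _ _ f g); pb
  | |- pbounded (fun x => @?f x * @?g x) => apply: (@pbounded_mul _ _ f g); pb
  | |- pbounded (fun _ => ?n) => exact: pbounded_const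
  | |- pbounded (fun x => sz x) => exact: pbounded_sz
  | |- pbounded (@sz _ _) => exact: pbounded_sz
  | |- _ => try assumption
  end.

Section Closure.

Context {S T U : Type} {cS : coded S} {cT : coded T} {cU : coded U}.

Lemma ptime_sz (f : S -> T) : ptime f -> pbounded (fun a => sz (f a)).
Proof.
case=> c [g pg hc]; apply: (@pbounded_le _ _ _ (fun a => sz a + g a)); first by pb.
move=> a; have [t le_t /run_store_size] := hc a [::] [::] [::] [::].
by rewrite /store_size /= !cats0 !addn0 => /leq_trans; apply; rewrite leq_add2l.
Qed.

(** Programs see only trees, so a function may be implemented at another type with the same codes:
    [cons] is pairing, and a number is its list of bits. *)
Lemma ptime_recode (f : S -> T) (f' : S -> U) :
  ptime f -> (forall a, code (f a) = code (f' a)) -> ptime f'.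
Proof.
case=> c [g pg hc] eq_f; exists c, g => // a A B C K.
by rewrite {2}/word -eq_f; apply: hc.
Qed.

Lemma ptime_ext (f f' : S -> T) : ptime f -> f =1 f' -> ptime f'.
Proof.
case=> c [g pg hc] eq_f; exists c, g => // a A B C K.
by rewrite -eq_f; apply: hc.
Qed.

Lemma ptime_id : ptime (fun a : S => a).
Proof. by exists Skip, (fun _ => 0) => *; [pb | apply: runs_skip]. Qed.

Lemma ptime_comp (f : S -> T) (g : T -> U) :
  ptime g -> ptime f -> ptime (fun a => g (f a)).
Proof.
case=> cg [hg pg rg] pf; have := pf; case=> cf [hf phf rf].
exists (cf ;; cg), (fun a => hf a + hg (f a)) => [|a A B C K].
  by apply: pbounded_add => //; apply: pbounded_comp => //; apply: ptime_sz.
exact: runs_seq (rf _ _ _ _ _) (rg _ _ _ _ _).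
Qed.

Lemma ptime_const (b : T) : ptime (fun _ : S => b).
Proof.
pose pushes := foldr (fun b c => c ;; Push RA b) Skip.
exists (drop_tree ;; pushes (word b)), (fun a => 40 * sz a + 40 + 2 * sz b) => [|a A B C K].
  by pb.
apply: runs_seq (runs_drop _ _ _ _ _) _.
rewrite /sz; elim: (word b) => [|x w IH] /=; first exact: runs_skip.
apply: runs_le; first exact: runs_seq IH (runs_push _ _ _).
lia.
Qed.

Lemma ptime_pair (f : S -> T) (g : S -> U) :
  ptime f -> ptime g -> ptime (fun a => (f a, g a)).
Proof.
move=> pf pg; have := pf; case=> cf [hf phf rf]; have := pg; case=> cg [hg phg rg].
have psf := ptime_sz pf.
exists (dup ;; cf ;; save RB ;; cg ;; restore RB ;; Push RA true).
exists (fun a => 120 * sz a + 120 + (hf a + ((40 * sz (f a) + 40) +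
  (hg a + ((40 * sz (f a) + 40) + 2))))) => [|a A B C K]; first by pb.
apply: runs_seq (runs_dup _ _ _ _ _) _; apply: runs_seq (rf _ _ _ _ _) _.
apply: runs_seq (runs_saveB _ _ _ _ _) _; apply: runs_seq (rg _ _ _ _ _) _.
apply: runs_seq (runs_restoreB _ _ _ _ _) _; rewrite word_pair cat_cons -catA.
exact: runs_push.
Qed.

Lemma ptime_fst : ptime (fun p : S * T => p.1).
Proof.
exists (Pop RA ;; save RB ;; drop_tree ;; restore RB).
exists (fun p => 1 + ((40 * sz p + 40) + ((40 * sz p + 40) + (40 * sz p + 40)))).
  by pb.
case=> a b A B C K; rewrite sz_pair word_pair cat_cons -catA.
apply: runs_seq (runs_pop _ _) _ => /=.
apply: runs_le; first apply: runs_seq (runs_saveB _ _ _ _ _) _.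
  by apply: runs_seq (runs_drop _ _ _ _ _) _; apply: runs_restoreB.
by rewrite /sz /word; lia.
Qed.

Lemma ptime_snd : ptime (fun p : S * T => p.2).
Proof.
exists (Pop RA ;; drop_tree), (fun p => 1 + (40 * sz p + 40)); first by pb.
case=> a b A B C K; rewrite sz_pair word_pair cat_cons -catA.
apply: runs_seq (runs_pop _ _) _ => /=.
by apply: runs_le (runs_drop _ _ _ _ _) _; rewrite /sz /word; lia.
Qed.

Lemma ptime_if (b : S -> bool) (f g : S -> T) :
  ptime b -> ptime f -> ptime g -> ptime (fun a => if b a then f a else g a).
Proof.
case=> cb [hb phb rb] [cf [hf phf rf]] [cg [hg phg rg]].
exists (dup ;; cb ;; If RA (Pop RA ;; Pop RA ;; Pop RA ;; cf) (Pop RA ;; cg)).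
exists (fun a => (120 * sz a + 120) + (hb a + ((3 + hf a + hg a) + 2))) => [|a A B C K].
  by pb.
apply: runs_seq (runs_dup _ _ _ _ _) _; apply: runs_seq (rb _ _ _ _ _) _.
apply: runs_if; case: (b a) => /=.
  apply: runs_le; first do 3!apply: runs_seq (runs_pop _ _) _ => /=.
    exact: rf.
  by lia.
apply: runs_le; first apply: runs_seq (runs_pop _ _) _ => /=.
  exact: rg.
by lia.
Qed.

End Closure.

(** All intermediate accumulators have to be bounded: a polynomial-time step may double its
    accumulator, and iterating it would give exponential size. *)
Lemma ptime_foldl X A R (cX : coded X) (cA : coded A) (cR : coded R)
    (h : X -> R -> A -> R) (b : X -> R) (l : X -> seq A) (q : X -> nat) :
  ptime (fun p : X * (A * R) => h p.1 p.2.2 p.2.1) -> ptime b -> ptime l ->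
  pbounded q ->
  (forall x l1 l2, l x = l1 ++ l2 -> sz (foldl (h x) (b x) l1) <= q x) ->
  ptime (fun x => foldl (h x) (b x) (l x)).
Proof.
case=> ch [gh pgh rh] pb' pl pq bound; have psl := ptime_sz pl.
have [c [g pg rc]] := ptime_pair (ptime_pair pl pb') (@ptime_id _ cX).
(* From the top, [RA] holds the rest of the list, the accumulator and [x]. The tail of the list and
   two copies of [x] go to [RC]; one copy is used up in building the argument of [ch], the other is
   put back below the new accumulator. *)
pose body := Pop RA ;; save RB ;; save RC ;; swap ;; dup ;; save RC ;; save RC ;;
  restore RB ;; Push RA true ;; restore RC ;; Push RA true ;; ch ;;
  restore RC ;; swap ;; restore RC.
have [k hk] := pgh.
pose N x := @sz _ cX x + @sz _ (coded_seq cA) (l x) + q x.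
pose B x := (N x + 4) ^ k.
(* Per pass: [B] pays for [ch], and 3000 generously covers the linear costs of all the moves in
   [body]. *)
pose M x := 3000 * N x + 3000 + B x.
have pB : pbounded B.
  case: psl pq => kl hl [kq hq].
  have [k' hk'] : pbounded (fun x => N x + 4).
    by rewrite /N; pb; [exists kl | exists kq].
  exists (k' * k) => x; rewrite /B expnM; case: (k) => // n.
  by rewrite leq_exp2r.
exists (c ;; Pop RA ;; Pop RA ;; While RA body ;; Pop RA ;; swap ;; drop_tree).
exists (fun x => g x + (1 + (1 + ((sz (l x) * M x + 1) + (1 +
  ((80 * N x + 160) + (40 * N x + 40))))))) => [|x a0 b0 c0 k0]; first by rewrite /M /N; pb.
apply: runs_seq (rc _ _ _ _ _) _; rewrite !word_pair /= -!catA.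
apply: runs_seq (runs_pop _ _) _ => /=; apply: runs_seq (runs_pop _ _) _ => /=.
have sz_fold l1 l2 : l x = l1 ++ l2 -> sz (foldl (h x) (b x) l1) <= q x by apply: bound.
have sz_all := sz_fold (l x) [::] (esym (cats0 _)).
apply: (@runs_seq _ _ _
  (Store (false :: word (foldl (h x) (b x) (l x)) ++ word x ++ a0) b0 c0 k0)); last first.
  apply: runs_seq (runs_pop _ _) _ => /=.
  apply: runs_seq.
    apply: runs_le (runs_swap _ _ _ _ _ _) _; rewrite -!/(word _) -!/(sz _) /N; lia.
  apply: runs_le (runs_drop _ _ _ _ _) _; rewrite -/(word _) -/(sz _) /N; lia.
have loop l2 : forall l1, l x = l1 ++ l2 ->
  runs (While RA body)
   (Store (word l2 ++ word (foldl (h x) (b x) l1) ++ word x ++ a0) b0 c0 k0)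
   (Store (false :: word (foldl (h x) (b x) (l x)) ++ word x ++ a0) b0 c0 k0)
   (size l2 * M x + 1).
  elim: l2 => [|y l2 IH] l1 eq_l.
    by rewrite eq_l cats0; apply: runs_while_end.
  have eq_l' : l x = rcons l1 y ++ l2 by rewrite cat_rcons.
  have {}IH := IH _ eq_l'; have sz1 := sz_fold _ _ eq_l; have sz2 := sz_fold _ _ eq_l'.
  have szl : sz y + sz l2 < sz (l x) + 1.
    have := @sz_cat _ cA l1 (y :: l2); rewrite -eq_l sz_cons.
    have := @sz_gt0 _ (coded_seq cA) l1.
    by lia.
  rewrite foldl_rcons in IH sz2; set acc := foldl _ _ l1 in IH sz1 sz2 *.
  have le_h : gh (x, (y, acc)) <= B x.
    apply: leq_trans (hk _) _; rewrite !sz_pair /B /N; case: (k) => // n.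
    by rewrite leq_exp2r //; lia.
  rewrite word_cons cat_cons -catA.
  apply: runs_le; first apply: runs_while IH => //.
    apply: runs_seq (runs_pop _ _) _ => /=.
    apply: runs_seq (runs_saveB _ _ _ _ _) _; apply: runs_seq (runs_saveC _ _ _ _ _) _.
    apply: runs_seq (runs_swap _ _ _ _ _ _) _; apply: runs_seq (runs_dup _ _ _ _ _) _.
    apply: runs_seq (runs_saveC _ _ _ _ _) _; apply: runs_seq (runs_saveC _ _ _ _ _) _.
    apply: runs_seq (runs_restoreB _ _ _ _ _) _; apply: runs_seq (runs_push _ _ _) _.
    apply: runs_seq (runs_restoreC _ _ _ _ _) _; apply: runs_seq (runs_push _ _ _) _.
    have := rh (x, (y, acc)) a0; rewrite !word_pair /= -!catA /= -!catA => rh'.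
    apply: runs_seq (rh' _ _ _) _.
    apply: runs_seq (runs_restoreC _ _ _ _ _) _; apply: runs_seq (runs_swap _ _ _ _ _ _) _.
    exact: runs_restoreC.
  by rewrite -!/(word _) -!/(sz _) /= mulSn /M /N; lia.
apply: runs_le (loop _ [::] erefl) _.
by rewrite leq_add2r leq_mul2r ltnW ?orbT // size_le_sz.
Qed.

(** * Lists *)

Lemma sz_bool (b : bool) : sz b <= 3.
Proof. by case: b. Qed.

Lemma sz_nil A {cA : coded A} : sz ([::] : seq A) = 1.
Proof. by []. Qed.

Lemma sz_rev A {cA : coded A} (l : seq A) : sz (rev l) = sz l.
Proof.
elim: l => // a l IH; rewrite rev_cons -cats1 sz_cons.
have := @sz_cat _ cA (rev l) [:: a]; rewrite sz_cons sz_nil IH; lia.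
Qed.

Lemma sz_behead A {cA : coded A} (l : seq A) : sz (behead l) <= sz l.
Proof. by case: l => // a l; rewrite sz_cons /=; lia. Qed.

Section Open.

Context {X A B : Type} {cX : coded X} {cA : coded A} {cB : coded B}.

Lemma ptime_app1 (f : X -> A * B) : ptime f -> ptime (fun x => (f x).1).
Proof. exact: ptime_comp ptime_fst. Qed.

Lemma ptime_app2 (f : X -> A * B) : ptime f -> ptime (fun x => (f x).2).
Proof. exact: ptime_comp ptime_snd. Qed.

Lemma ptime_and (b c : X -> bool) :
  ptime b -> ptime c -> ptime (fun x => b x && c x).
Proof. by move=> pb pc; exact: (ptime_if pb pc (ptime_const false)). Qed.

Lemma ptime_or (b c : X -> bool) :
  ptime b -> ptime c -> ptime (fun x => b x || c x).
Proof. by move=> pb pc; exact: (ptime_if pb (ptime_const true) pc). Qed.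

Lemma ptime_not (b : X -> bool) : ptime b -> ptime (fun x => ~~ b x).
Proof. by move=> pb; exact: (ptime_if pb (ptime_const false) (ptime_const true)). Qed.

Lemma ptime_cons (f : X -> A) (l : X -> seq A) :
  ptime f -> ptime l -> ptime (fun x => f x :: l x).
Proof. by move=> pf pl; apply: ptime_recode (ptime_pair pf pl) _. Qed.

Lemma ptime_behead (l : X -> seq A) : ptime l -> ptime (fun x => behead (l x)).
Proof.
apply: (@ptime_comp _ _ _ _ _ _ l behead).
exists (If RA (Pop RA ;; drop_tree) Skip), (fun l => 40 * sz l + 41 + 2); first by pb.
move=> [|a l'] a0 b0 c0 k0; first by apply: runs_if; apply: runs_le (runs_skip _) _.
rewrite word_cons cat_cons -catA; apply: runs_if; apply: runs_le.
  by apply: runs_seq (runs_pop _ _) _; apply: runs_drop.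
by rewrite sz_cons /sz /word; lia.
Qed.

Lemma ptime_nilp (l : X -> seq A) : ptime l -> ptime (fun x => nilp (l x)).
Proof.
apply: (@ptime_comp _ _ _ _ _ _ l (@nilp A)).
exists (If RA (drop_tree ;; Push RA false)
  (Push RA false ;; Push RA true)).
exists (fun l => (40 * sz l + 44) + 2); first by pb.
move=> [|a l'] a0 b0 c0 k0; apply: runs_if.
  apply: runs_le; first apply: runs_seq (runs_push _ _ _) _.
    exact: runs_push.
  by rewrite addnC; lia.
apply: runs_le; first apply: runs_seq (runs_drop (code (a :: l')) _ _ _ _) _.
  exact: runs_push.
by rewrite -!/(word _) -!/(sz _); lia.
Qed.

Lemma ptime_head (d : X -> A) (l : X -> seq A) :
  ptime d -> ptime l -> ptime (fun x => head (d x) (l x)).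
Proof.
move=> pd pl.
have ph : ptime (fun p : seq A * A => head p.2 p.1); last first.
  exact: (ptime_comp ph (ptime_pair pl pd)).
exists (Pop RA ;; If RA (Pop RA ;; save RB ;; drop_tree ;; drop_tree ;; restore RB) (Pop RA)).
exists (fun p => 1 + (160 * sz p + 200)); first by pb.
move=> [l1 d1] a0 b0 c0 k0; rewrite word_pair cat_cons -catA.
apply: runs_seq (runs_pop _ _) _ => /=; case: l1 => [|a l1].
  by apply: runs_le; first apply: runs_if; [exact: runs_pop | lia].
rewrite word_cons cat_cons -catA; apply: runs_le; first apply: runs_if.
  apply: runs_seq (runs_pop _ _) _; apply: runs_seq (runs_saveB _ _ _ _ _) _.
  apply: runs_seq (runs_drop _ _ _ _ _) _; apply: runs_seq (runs_drop _ _ _ _ _) _.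
  exact: runs_restoreB.
by rewrite sz_pair sz_cons -!/(word _) -!/(sz _); lia.
Qed.

(** The growth per step does not depend on the accumulator, so the total growth is at most the
    length of the list times one bound. *)
Lemma ptime_foldl_additive (h : X -> B -> A -> B) (b : X -> B) (l : X -> seq A)
    (q : X * A -> nat) :
  ptime (fun p : X * (A * B) => h p.1 p.2.2 p.2.1) -> ptime b -> ptime l ->
  pbounded q ->
  (forall x r a, sz (h x r a) <= sz r + q (x, a)) ->
  ptime (fun x => foldl (h x) (b x) (l x)).
Proof.
move=> ph pb' pl [k hk] bound.
pose Q x := @sz _ cX x + @sz _ (coded_seq cA) (l x).
have pQ : pbounded (fun x => (Q x + 3) ^ k).
  have [k' hk'] : pbounded (fun x => Q x + 3) by rewrite /Q; pb; apply: ptime_sz.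
  exists (k' * k) => x; rewrite expnM; case: (k) => // n; by rewrite leq_exp2r.
have psl := ptime_sz pl; have psb := ptime_sz pb'.
apply: (ptime_foldl (q := fun x => sz (b x) + sz (l x) * (Q x + 3) ^ k)) => //.
  by pb.
move=> x l1 l2 eq_l.
have : sz (foldl (h x) (b x) l1) <= sz (b x) + size l1 * (Q x + 3) ^ k.
  elim/last_ind: l1 l2 eq_l => [|l1 a IH] l2 eq_l; first by rewrite addn0.
  have {}IH : sz (foldl (h x) (b x) l1) <= sz (b x) + size l1 * (Q x + 3) ^ k.
    by apply: (IH (a :: l2)); rewrite eq_l cat_rcons.
  rewrite foldl_rcons size_rcons; apply: leq_trans (bound _ _ _) _.
  suff : q (x, a) <= (Q x + 3) ^ k by rewrite mulSn; lia.
  apply: leq_trans (hk _) _; case: (k) => // n; rewrite leq_exp2r // sz_pair /Q.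
  have := @sz_cat _ cA l1 (a :: l2).
  rewrite -cat_rcons -eq_l sz_cons; have := @sz_gt0 _ (coded_seq cA) l1; lia.
move=> /leq_trans; apply; rewrite leq_add2l leq_mul2r; apply/orP; right.
have := @size_le_sz _ cA (l x); rewrite eq_l size_cat; lia.
Qed.

End Open.

Section Folds.

Context {X A B : Type} {cX : coded X} {cA : coded A} {cB : coded B}.

Lemma ptime_rev (l : X -> seq A) : ptime l -> ptime (fun x => rev (l x)).
Proof.
move=> pl; apply: (ptime_ext (f := fun x => foldl (fun r a => a :: r) [::] (l x))).
  apply: (ptime_foldl_additive (q := fun p => sz p)) => //; first 2 last.
  - exact: pbounded_sz.
  - by move=> x r a; rewrite sz_cons sz_pair; lia.
  - by apply: ptime_cons; [apply: ptime_app1 | apply: ptime_app2]; exact: ptime_snd.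
  - exact: ptime_const.
by move=> x; rewrite /rev; elim: (l x) [::] => //= a s IH r.
Qed.

Lemma ptime_foldr (h : X -> A -> B -> B) (b : X -> B) (l : X -> seq A) (q : X -> nat) :
  ptime (fun p : X * (A * B) => h p.1 p.2.1 p.2.2) -> ptime b -> ptime l ->
  pbounded q ->
  (forall x l1 l2, l x = l1 ++ l2 -> sz (foldr (h x) (b x) l2) <= q x) ->
  ptime (fun x => foldr (h x) (b x) (l x)).
Proof.
move=> ph pb' pl pq bound.
apply: (ptime_ext (f := fun x => foldl (fun r a => h x a r) (b x) (rev (l x)))); last first.
  by move=> x; rewrite foldl_rev.
apply: (ptime_foldl (q := q)) => //; first exact: ptime_rev.
move=> x l1 l2 eq_l; rewrite -[l1]revK foldl_rev; apply: (bound _ (rev l2)).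
by rewrite -rev_cat -eq_l revK.
Qed.

Lemma ptime_foldr_additive (h : X -> A -> B -> B) (b : X -> B) (l : X -> seq A)
    (q : X * A -> nat) :
  ptime (fun p : X * (A * B) => h p.1 p.2.1 p.2.2) -> ptime b -> ptime l ->
  pbounded q ->
  (forall x r a, sz (h x a r) <= sz r + q (x, a)) ->
  ptime (fun x => foldr (h x) (b x) (l x)).
Proof.
move=> ph pb' pl pq bound.
apply: (ptime_ext (f := fun x => foldl (fun r a => h x a r) (b x) (rev (l x)))); last first.
  by move=> x; rewrite foldl_rev.
by apply: (ptime_foldl_additive (q := q)) => //; exact: ptime_rev.
Qed.

End Folds.

(** A hook, redefined whenever new closure lemmas are available; [pt] decomposes a function along
    its syntax. *)
Ltac pt_extra := fail.

Ltac pt_step :=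
  lazymatch goal with
  | |- ptime (fun x => x) => exact: ptime_id
  | |- ptime (fun _ => ?c) => exact: ptime_const
  | |- ptime fst => exact: ptime_fst
  | |- ptime snd => exact: ptime_snd
  | |- ptime (fun x => fst x) => exact: ptime_fst
  | |- ptime (fun x => snd x) => exact: ptime_snd
  | |- ptime (fun x => fst (@?f x)) => simple apply (@ptime_app1 _ _ _ _ _ _ f)
  | |- ptime (fun x => snd (@?f x)) => simple apply (@ptime_app2 _ _ _ _ _ _ f)
  | |- ptime (fun x => (@?f x, @?g x)) => simple apply (@ptime_pair _ _ _ _ _ _ f g)
  | |- ptime (fun x => cons (@?f x) (@?g x)) => simple apply (@ptime_cons _ _ _ _ f g)
  | |- ptime (fun x => @?b x && @?c x) => simple apply (@ptime_and _ _ b c)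
  | |- ptime (fun x => @?b x || @?c x) => simple apply (@ptime_or _ _ b c)
  | |- ptime (fun x => ~~ @?b x) => simple apply (@ptime_not _ _ b)
  | |- ptime (fun x => nilp (@?l x)) => simple apply (@ptime_nilp _ _ _ _ l)
  | |- ptime (fun x => behead (@?l x)) => simple apply (@ptime_behead _ _ _ _ l)
  | |- ptime (fun x => rev (@?l x)) => simple apply (@ptime_rev _ _ _ _ l)
  | |- ptime (fun x => head (@?d x) (@?l x)) => simple apply (@ptime_head _ _ _ _ d l)
  | |- _ => first [assumption | pt_extra | simple apply ptime_if]
  end.

Ltac pt := repeat pt_step.

Section Lists.

Context {X A B : Type} {cX : coded X} {cA : coded A} {cB : coded B}.

Lemma ptime_cat (l m : X -> seq A) : ptime l -> ptime m -> ptime (fun x => l x ++ m x).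
Proof.
move=> pl pm; apply: (ptime_ext (f := fun x => foldr cons (m x) (l x))); last first.
  by move=> x; elim: (l x) => //= a s ->.
apply: (ptime_foldr_additive (h := fun _ => cons) (q := fun p => sz p)) => //; first by pt.
  by pb.
by move=> x r a; rewrite sz_cons sz_pair; lia.
Qed.

Lemma ptime_map (f : X -> A -> B) (l : X -> seq A) :
  ptime (fun p => f p.1 p.2) -> ptime l -> ptime (fun x => map (f x) (l x)).
Proof.
move=> pf pl; apply: (ptime_ext (f := fun x => foldr (fun a r => f x a :: r) [::] (l x))) => //.
apply: (ptime_foldr_additive (h := fun x a r => f x a :: r) (b := fun _ => [::])
  (q := fun p => sz (f p.1 p.2) + 1)) => //; last first.
- by move=> x r a; rewrite sz_cons /=; lia.
- by pb; exact: ptime_sz pf.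
- by pt.
have -> : (fun p : X * (A * seq B) => f p.1 p.2.1 :: p.2.2) =
  (fun p => (fun q : X * A => f q.1 q.2) (p.1, p.2.1) :: p.2.2) by [].
by apply: ptime_cons; [apply: (ptime_comp pf) |]; pt.
Qed.

Lemma ptime_filter (f : X -> A -> bool) (l : X -> seq A) :
  ptime (fun p => f p.1 p.2) -> ptime l -> ptime (fun x => filter (f x) (l x)).
Proof.
move=> pf pl.
apply: (ptime_foldr_additive (h := fun x a r => if f x a then a :: r else r) (b := fun _ => [::])
  (q := fun p => sz p)) => //; last first.
- by move=> x r a; case: ifP; rewrite ?sz_cons sz_pair; lia.
- by pb.
- by pt.
by apply: ptime_if; [apply: (ptime_comp pf (f := fun p : X * (A * seq A) => (p.1, p.2.1))) | |]; pt.
Qed.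

Lemma ptime_has (f : X -> A -> bool) (l : X -> seq A) :
  ptime (fun p => f p.1 p.2) -> ptime l -> ptime (fun x => has (f x) (l x)).
Proof.
move=> pf pl; apply: (ptime_ext (f := fun x => foldr (fun a r => f x a || r) false (l x))).
  apply: (ptime_foldr_additive (h := fun x a r => f x a || r) (b := fun _ => false)
    (q := fun p => 3)) => //; last first.
  - by move=> x r a; have := sz_bool (f x a || r); lia.
  - by pb.
  - by pt.
  by apply: ptime_or; [apply: (ptime_comp pf (f := fun p : X * (A * bool) => (p.1, p.2.1))) |]; pt.
by move=> x; elim: (l x) => //= a s ->.
Qed.

End Lists.

Section Flatten.

Context {X A : Type} {cX : coded X} {cA : coded A}.

Lemma ptime_flatten (l : X -> seq (seq A)) : ptime l -> ptime (fun x => flatten (l x)).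
Proof.
move=> pl.
apply: (ptime_foldr_additive (h := fun _ => cat) (b := fun _ => [::])
  (q := fun p => sz p)) => //; last first.
- move=> x r a; rewrite sz_pair; have := @sz_cat _ cA a r; lia.
- by pb.
- by pt.
by apply: ptime_cat; pt.
Qed.

End Flatten.

(** * Binary arithmetic on lists of bits *)

Definition val_bits (s : seq bool) : nat := foldr (fun (b : bool) n => b + n.*2) 0 s.

Lemma bits_of_nat_cons (b : bool) n :
  bits_of_nat (b + n.*2) = if b || (0 < n) then b :: bits_of_nat n else [::].
Proof.
case: n => [|n]; first by case: b.
rewrite orbT /bits_of_nat.
have [p eq_p] : exists p, bin_of_nat n.+1 = BinNums.Npos p.
  have := bin_of_natK n.+1; case: (bin_of_nat _) => // p _; by exists p.
have eq_n := bin_of_natK n.+1; rewrite eq_p in eq_n *.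
have -> : bin_of_nat (b + n.+1.*2) =
  BinNums.Npos (if b then BinNums.xI p else BinNums.xO p).
  apply: (can_inj nat_of_binK); rewrite bin_of_natK -eq_n.
  by case: b => /=; rewrite natTrecE ?add1n.
by case: b.
Qed.

Lemma bits_of_natK : cancel bits_of_nat val_bits.
Proof.
move=> n; elim/ltn_ind: n => n IH.
rewrite -{1}[n]odd_double_half bits_of_nat_cons.
case: ifP => [|/negbT].
  move=> h; rewrite /= IH ?odd_double_half //.
  by move: h; case: (n) => // m _; rewrite ltn_half_double; lia.
by rewrite negb_or -leqNgt leqn0 => /andP [/negbTE odd_n /eqP n2]; 
  rewrite -[RHS]odd_double_half odd_n n2.
Qed.

Lemma val_bits_lt s : val_bits s < 2 ^ size s.
Proof. elim: s => //= b s; rewrite expnS; case: b; lia. Qed.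

Lemma val_bits_cat s t : val_bits (s ++ t) = val_bits s + 2 ^ size s * val_bits t.
Proof. elim: s => [|b s /= ->]; rewrite ?expn0 ?mul1n //= expnS; lia. Qed.

Definition blen (n : nat) : nat := size (bits_of_nat n).

Lemma blen_le n k : (blen n <= k) = (n < 2 ^ k).
Proof.
elim: k n => [|k IH] n.
  rewrite leqn0 size_eq0 expn0 ltnS leqn0; apply/eqP/eqP => [h|->//].
  by rewrite -[n]bits_of_natK h.
rewrite -[in LHS](odd_double_half n) /blen bits_of_nat_cons.
have -> : (n < 2 ^ k.+1) = (n./2 < 2 ^ k).
  by rewrite expnS; lia.
rewrite -IH; case: ifP => //= /negbT; rewrite negb_or -leqNgt leqn0 => /andP [_ /eqP ->].
by [].
Qed.

Lemma sz_bits (s : seq bool) : 2 * size s < sz s <= 4 * size s + 1.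
Proof.
by elim: s => // b s IH; rewrite sz_cons /=; have : 1 <= sz b <= 3; [case: b | lia].
Qed.

Lemma sz_nat (n : nat) : 2 * blen n < sz n <= 4 * blen n + 1.
Proof. exact: (sz_bits (bits_of_nat n)). Qed.

Lemma lt_exp_blen n : n < 2 ^ blen n.
Proof. by rewrite -blen_le. Qed.

Lemma blen_add m n : blen (m + n) <= blen m + blen n.
Proof.
rewrite blen_le; have := lt_exp_blen m; have := lt_exp_blen n.
case: (blen n) => [|k]; first by rewrite expn0 addn0 ltnS leqn0 => /eqP ->; rewrite addn0.
case: (blen m) => [|l]; first by rewrite expn0 ltnS leqn0 => ? /eqP ->.
have := expn_gt0 2 k; have := expn_gt0 2 l.
by rewrite addSn addnS !expnS expnD; nia.
Qed.

Lemma blen_mul m n : blen (m * n) <= blen m + blen n.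
Proof.
rewrite blen_le expnD; have := lt_exp_blen m; have := lt_exp_blen n.
case: n => [|n] hn hm; first by rewrite muln0 muln_gt0 !expn_gt0.
by apply: ltn_mul.
Qed.

Lemma blen_mono m n : m <= n -> blen m <= blen n.
Proof. by rewrite blen_le => /leq_ltn_trans; apply; rewrite -blen_le. Qed.

Section Bits.

Context {X : Type} {cX : coded X}.

Lemma ptime_bits (f : X -> nat) : ptime f -> ptime (fun x => bits_of_nat (f x)).
Proof. by move=> pf; apply: ptime_recode pf _. Qed.

(** A list of bits may have zeros at its most significant end while the code of a number has none.
    Folding from that end removes them. *)
Lemma ptime_val (s : X -> seq bool) : ptime s -> ptime (fun x => val_bits (s x)).
Proof.
move=> ps; apply: (ptime_recode (f := fun x =>
  foldr (fun b r => if b || ~~ nilp r then b :: r else [::]) [::] (s x))); last first.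
  move=> x; congr tree_of_seq; elim: (s x) => //= b t ->.
  rewrite bits_of_nat_cons; congr (if _ || _ then _ else _).
  by rewrite /nilp -leqn0 blen_le expn0 ltnS leqn0 lt0n.
apply: (ptime_foldr_additive (h := fun _ b r => if b || ~~ nilp r then b :: r else [::])
  (b := fun _ => [::]) (q := fun p => sz p)) => //; [by pt|by pt|by pb|].
move=> x r a; rewrite sz_pair; case: ifP => _; rewrite ?sz_cons ?sz_nil; lia.
Qed.

End Bits.

(* The state is (carry, (rest of [xs], (rest of [ys], output))), the output
   having its most significant bit first. *)
Definition transduce (d : bool -> bool -> bool -> bool * bool) (xs ys : seq bool) :=
  foldl (fun st (_ : bool) =>
      let r := d st.1 (head false st.2.1) (head false st.2.2.1) in
      (r.2, (behead st.2.1, (behead st.2.2.1, r.1 :: st.2.2.2))))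
    (false, (xs, (ys, [::]))) (xs ++ ys).

Lemma ptime_transduce X (cX : coded X) d (xs ys : X -> seq bool) :
  ptime (fun p : bool * (bool * bool) => d p.1 p.2.1 p.2.2) ->
  ptime xs -> ptime ys ->
  ptime (fun x => transduce d (xs x) (ys x)).
Proof.
move=> pd px py.
have pd' Y (cY : coded Y) (f g h : Y -> bool) :
  ptime f -> ptime g -> ptime h -> ptime (fun y => d (f y) (g y) (h y)).
  by move=> pf pg ph; apply: (ptime_comp pd (ptime_pair pf (ptime_pair pg ph))).
apply: (ptime_foldl_additive
  (h := fun (_ : X) (st : bool * (seq bool * (seq bool * seq bool))) (_ : bool) =>
      let r := d st.1 (head false st.2.1) (head false st.2.2.1) in
      (r.2, (behead st.2.1, (behead st.2.2.1, r.1 :: st.2.2.2))))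
  (q := fun _ => 6)) => /=.
- by apply: ptime_pair; [apply: ptime_app2|apply: ptime_pair; [|apply: ptime_pair;
   [|apply: ptime_cons; [apply: ptime_app1|]]]]; try apply: pd'; pt.
- by pt.
- by apply: ptime_cat; pt.
- by pb.
move=> x [c [u [v w]]] _ /=; rewrite !sz_pair sz_cons.
have := @sz_behead _ coded_bool u; have := @sz_behead _ coded_bool v.
have := sz_bool (d c (head false u) (head false v)).1.
have := sz_bool (d c (head false u) (head false v)).2; have := @sz_gt0 _ coded_bool c.
by lia.
Qed.

(** Full adder and full subtractor, returning the digit and the outgoing carry. They are written
    with conditionals because [pt] can treat these. *)
Definition carry (c x y : bool) : bool * bool :=
  (if c then (if x then y else ~~ y) else (if x then ~~ y else y), if c then x || y else x && y).
Definition borrow (c x y : bool) : bool * bool :=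
  (if c then (if x then y else ~~ y) else (if x then ~~ y else y), if x then c && y else c || y).

Lemma transduce_add xs ys :
  let st := transduce carry xs ys in
  val_bits (rev (st.1 :: st.2.2.2)) = val_bits xs + val_bits ys.
Proof.
rewrite /transduce; set step := (fun st _ => _).
(* Invariant: the digits written so far, plus the carry and the unread operands at the current power
   of 2, keep the same value. *)
have inv k (st : bool * (seq bool * (seq bool * seq bool))) (fuel : seq bool) :
    val_bits (rev st.2.2.2) + 2 ^ size st.2.2.2 * (st.1 + val_bits st.2.1 + val_bits st.2.2.1) = k ->
    size st.2.1 + size st.2.2.1 <= size fuel ->
    val_bits (rev ((foldl step st fuel).1 :: (foldl step st fuel).2.2.2)) = k.
  elim: fuel st => [|b fuel IH] [c [u [v w]]] /=.
    case: u; case: v => //= <- _; rewrite rev_cons -cats1 val_bits_cat size_rev /=.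
    by case: c; rewrite /= ?muln0 //; lia.
  move=> eq_k le_s; apply: IH => /=; last by rewrite !size_behead; lia.
  rewrite -eq_k rev_cons -cats1 val_bits_cat size_rev expnS /=.
  by case: u {eq_k le_s} => [|[] u] /=; case: v => [|[] v] /=; case: c => /=; lia.
apply: inv => /=; last by rewrite size_cat.
by rewrite expn0 mul1n.
Qed.

(** A final borrow means that a power of 2 had to be added to [xs]. As the digits written are below
    that power, the borrow decides the comparison; see [transduce_ltn]. *)
Lemma transduce_sub xs ys :
  let st := transduce borrow xs ys in
  val_bits xs + 2 ^ size st.2.2.2 * st.1 = val_bits (rev st.2.2.2) + val_bits ys.
Proof.
rewrite /transduce; set step := (fun st _ => _).
have inv (st : bool * (seq bool * (seq bool * seq bool))) (fuel : seq bool) :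
    val_bits (rev st.2.2.2) + 2 ^ size st.2.2.2 * val_bits st.2.1 + val_bits ys =
      val_bits xs + 2 ^ size st.2.2.2 * (st.1 + val_bits st.2.2.1) ->
    size st.2.1 + size st.2.2.1 <= size fuel ->
    let st' := foldl step st fuel in
    val_bits xs + 2 ^ size st'.2.2.2 * st'.1 = val_bits (rev st'.2.2.2) + val_bits ys.
  elim: fuel st => [|b fuel IH] [c [u [v w]]] /=.
    by case: u; case: v => //= + _; rewrite addn0 muln0 addn0 => ->.
  move=> eq_k le_s; apply: IH => /=; last by rewrite !size_behead; lia.
  move: eq_k; rewrite rev_cons -cats1 val_bits_cat size_rev expnS /=.
  by case: u {le_s} => [|[] u] /=; case: v => [|[] v] /=; case: c => /=; lia.
apply: inv => /=; last by rewrite size_cat.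
by rewrite expn0 !mul1n.
Qed.

Lemma transduce_ltn m n :
  (transduce borrow (bits_of_nat m) (bits_of_nat n)).1 = (m < n).
Proof.
have := transduce_sub (bits_of_nat m) (bits_of_nat n).
case: (transduce _ _ _) => c [u [v w]] /=; rewrite !bits_of_natK.
have := val_bits_lt (rev w); rewrite size_rev; case: c; lia.
Qed.

Section Arithmetic.

Context {X : Type} {cX : coded X}.

Lemma ptime_add (f g : X -> nat) : ptime f -> ptime g -> ptime (fun x => f x + g x).
Proof.
move=> pf pg; pose st x := transduce carry (bits_of_nat (f x)) (bits_of_nat (g x)).
have pst : ptime st.
  by apply: ptime_transduce; [rewrite /carry| |]; try apply: ptime_bits => //; pt.
apply: (ptime_ext (f := fun x => val_bits (rev ((st x).1 :: (st x).2.2.2)))).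
  by apply: ptime_val; pt.
by move=> x; rewrite transduce_add !bits_of_natK.
Qed.

Lemma ptime_ltn (f g : X -> nat) : ptime f -> ptime g -> ptime (fun x => f x < g x).
Proof.
move=> pf pg; pose st x := transduce borrow (bits_of_nat (f x)) (bits_of_nat (g x)).
have pst : ptime st.
  by apply: ptime_transduce; [rewrite /borrow| |]; try apply: ptime_bits => //; pt.
apply: (ptime_ext (f := fun x => (st x).1)); first by pt.
by move=> x; apply: transduce_ltn.
Qed.

Lemma ptime_sub (f g : X -> nat) : ptime f -> ptime g -> ptime (fun x => f x - g x).
Proof.
move=> pf pg; pose st x := transduce borrow (bits_of_nat (f x)) (bits_of_nat (g x)).
have pst : ptime st.
  by apply: ptime_transduce; [rewrite /borrow| |]; try apply: ptime_bits => //; pt.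
apply: (ptime_ext (f := fun x => if (st x).1 then 0 else val_bits (rev (st x).2.2.2))).
  by apply: ptime_if; [pt | pt | apply: ptime_val; pt].
move=> x; have := transduce_sub (bits_of_nat (f x)) (bits_of_nat (g x)).
have := transduce_ltn (f x) (g x); rewrite -/(st x) /= !bits_of_natK => ->.
case: ltnP; rewrite ?muln0; lia.
Qed.

Lemma ptime_leq (f g : X -> nat) : ptime f -> ptime g -> ptime (fun x => f x <= g x).
Proof.
move=> pf pg; apply: (ptime_ext (f := fun x => ~~ (g x < f x))).
  by pt; apply: ptime_ltn.
by move=> x; rewrite -leqNgt.
Qed.

Lemma ptime_eqn (f g : X -> nat) : ptime f -> ptime g -> ptime (fun x => f x == g x).
Proof.
move=> pf pg; apply: (ptime_ext (f := fun x => (f x <= g x) && (g x <= f x))).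
  by pt; apply: ptime_leq.
by move=> x; rewrite eqn_leq.
Qed.

Lemma ptime_half (f : X -> nat) : ptime f -> ptime (fun x => (f x)./2).
Proof.
move=> pf; apply: (ptime_ext (f := fun x => val_bits (behead (bits_of_nat (f x))))).
  by apply: ptime_val; pt; apply: ptime_bits.
move=> x; rewrite -[in LHS](odd_double_half (f x)) bits_of_nat_cons.
case: ifP => /=; first by rewrite bits_of_natK.
by move/negbT; rewrite negb_or -leqNgt leqn0 => /andP [_ /eqP ->].
Qed.

Lemma ptime_odd (f : X -> nat) : ptime f -> ptime (fun x => odd (f x)).
Proof.
move=> pf; apply: (ptime_ext (f := fun x => head false (bits_of_nat (f x)))).
  by pt; apply: ptime_bits.
move=> x; rewrite -[in LHS](odd_double_half (f x)) bits_of_nat_cons.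
by case: ifP => //= /negbT; rewrite negb_or => /andP [/negbTE -> _].
Qed.

Lemma ptime_min (f g : X -> nat) : ptime f -> ptime g -> ptime (fun x => minn (f x) (g x)).
Proof. by move=> pf pg; apply: ptime_if => //; apply: ptime_ltn. Qed.

End Arithmetic.

Ltac pt_arith :=
  match goal with
  | |- ptime (fun x => @?f x + @?g x) => simple apply (@ptime_add _ _ f g)
  | |- ptime (fun x => @?f x - @?g x) => simple apply (@ptime_sub _ _ f g)
  | |- ptime (fun x => minn (@?f x) (@?g x)) => simple apply (@ptime_min _ _ f g)
  | |- ptime (fun x => half (@?f x)) => simple apply (@ptime_half _ _ f)
  | |- ptime (fun x => odd (@?f x)) => simple apply (@ptime_odd _ _ f)
  | |- ptime (fun x => @?f x < @?g x) => simple apply (@ptime_ltn _ _ f g)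
  | |- ptime (fun x => @?f x <= @?g x) => simple apply (@ptime_leq _ _ f g)
  | |- ptime (fun x => @?f x == @?g x) => simple apply (@ptime_eqn _ _ f g)
  | |- ptime (fun x => @?f x ++ @?g x) => simple apply (@ptime_cat _ _ _ _ f g)
  | |- ptime (fun x => flatten (@?f x)) => simple apply (@ptime_flatten _ _ _ _ f)
  | |- ptime (fun x => map (@?f x) (@?l x)) =>
       simple apply (@ptime_map _ _ _ _ _ _ f l); cbv beta
  | |- ptime (fun x => filter (@?f x) (@?l x)) =>
       simple apply (@ptime_filter _ _ _ _ f l); cbv beta
  | |- ptime (fun x => has (@?f x) (@?l x)) =>
       simple apply (@ptime_has _ _ _ _ f l); cbv beta
  end.
Ltac pt_extra ::= pt_arith.

Section Product.

Context {X : Type} {cX : coded X}.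

Lemma ptime_mul (f g : X -> nat) : ptime f -> ptime g -> ptime (fun x => f x * g x).
Proof.
move=> pf pg.
(* Horner's scheme: the accumulator is the value of a suffix of the bits times [g x], which bounds
   its size. *)
pose h x (b : bool) acc := (if b then g x else 0) + (acc + acc).
have eq_h x s : foldr (h x) 0 s = val_bits s * g x.
  by elim: s => //= b s ->; rewrite /h -muln2; case: b; lia.
apply: (ptime_ext (f := fun x => foldr (h x) 0 (bits_of_nat (f x)))); last first.
  by move=> x; rewrite eq_h bits_of_natK.
apply: (ptime_foldr (q := fun x => 4 * (sz (f x) + sz (g x)) + 1)) => //.
- rewrite /h; pt; exact: ptime_comp pg ptime_fst.
- exact: ptime_const.
- by pb; apply: ptime_sz.
move=> x l1 l2 eq_l; rewrite eq_h.
have /andP [_ h1] := sz_nat (val_bits l2 * g x); have := blen_mul (val_bits l2) (g x).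
have : blen (val_bits l2) <= size l2 by rewrite blen_le val_bits_lt.
have : size l2 <= blen (f x) by rewrite /blen eq_l size_cat leq_addl.
have /andP [h2 _] := sz_nat (f x); have /andP [h3 _] := sz_nat (g x); lia.
Qed.

End Product.

Section IteratedOperations.

Context {X : Type} {cX : coded X}.

Lemma ptime_sumn (l : X -> seq nat) : ptime l -> ptime (fun x => sumn (l x)).
Proof.
move=> pl; apply: (ptime_foldr (h := fun _ => addn) (q := fun x => 4 * sz (l x) + 1)).
- by pt.
- by pt.
- by [].
- by pb; apply: ptime_sz.
move=> x l1 l2 eq_l; apply: (@leq_trans (4 * sz l2 + 1)).
  have : blen (sumn l2) <= sz l2.
    elim: l2 {eq_l} => //= n l2 IH; rewrite sz_cons; apply: leq_trans (blen_add _ _) _.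
    have /andP [] := sz_nat n; lia.
  have /andP [_] := sz_nat (sumn l2); rewrite /sumn; lia.
by have := @sz_cat _ coded_nat l1 l2; rewrite -eq_l; have := @sz_gt0 _ (coded_seq coded_nat) l1; lia.
Qed.

Lemma ptime_prodn (l : X -> seq nat) : ptime l -> ptime (fun x => foldr muln 1 (l x)).
Proof.
move=> pl; apply: (ptime_foldr (h := fun _ => muln) (q := fun x => 4 * sz (l x) + 1)).
- by apply: ptime_mul; pt.
- by pt.
- by [].
- by pb; apply: ptime_sz.
move=> x l1 l2 eq_l; apply: (@leq_trans (4 * sz l2 + 1)).
  have : blen (foldr muln 1 l2) <= sz l2.
    elim: l2 {eq_l} => //= n l2 IH; rewrite sz_cons; apply: leq_trans (blen_mul _ _) _.
    have /andP [] := sz_nat n; lia.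
  have /andP [_] := sz_nat (foldr muln 1 l2); lia.
by have := @sz_cat _ coded_nat l1 l2; rewrite -eq_l; have := @sz_gt0 _ (coded_seq coded_nat) l1; lia.
Qed.

End IteratedOperations.

Lemma pbounded_mem X A (cX : coded X) (cA : coded A) (l : X -> seq A) (q : X * A -> nat) :
  ptime l -> pbounded q ->
  exists2 Q, pbounded Q &
    forall x l1 a l2, l x = l1 ++ a :: l2 -> q (x, a) <= Q x.
Proof.
move=> pl [k hk]; exists (fun x => (sz (x, l x) + 2) ^ k); last first.
  move=> x l1 a l2 eq_l; apply: leq_trans (hk _) _.
  case: k {hk} => // k; rewrite leq_exp2r // !sz_pair.
  have := @sz_cat _ cA l1 (a :: l2); rewrite -eq_l sz_cons.
  by have := @sz_gt0 _ (coded_seq cA) l1; lia.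
have pp : ptime (fun x => (x, l x)) by apply: ptime_pair => //; apply: ptime_id.
by apply: (@pbounded_comp _ _ _ _ (fun x => (x, l x)) (fun y => (sz y + 2) ^ k));
  [exists k | apply: ptime_sz].
Qed.

(** For accumulators that a step either keeps or replaces by something whose size does not depend on
    them, such as a capped table. *)
Lemma ptime_foldl_max X A B (cX : coded X) (cA : coded A) (cB : coded B)
    (h : X -> B -> A -> B) (b : X -> B) (l : X -> seq A) (q : X * A -> nat) :
  ptime (fun p : X * (A * B) => h p.1 p.2.2 p.2.1) -> ptime b -> ptime l ->
  pbounded q ->
  (forall x r a, sz (h x r a) <= maxn (sz r) (q (x, a))) ->
  ptime (fun x => foldl (h x) (b x) (l x)).
Proof.
move=> ph pb' pl pq bound; have [Q pQ le_Q] := pbounded_mem pl pq.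
have psb := ptime_sz pb'.
apply: (ptime_foldl (q := fun x => sz (b x) + Q x)) => //; first by pb.
move=> x l1; elim/last_ind: l1 => [|l1 a IH] l2 eq_l; first exact: leq_addr.
rewrite foldl_rcons; apply: leq_trans (bound _ _ _) _.
rewrite cat_rcons in eq_l; rewrite geq_max (IH _ eq_l) /=.
by apply: leq_trans (leq_addl _ _); apply: le_Q eq_l.
Qed.

(** * Tables *)

Definition get1 (m : seq (nat * nat)) (u : nat) : nat :=
  foldr (fun p r => if p.1 == u then p.2 else r) 0 m.

Definition get2 (m : seq (nat * nat * nat)) (u v : nat) : nat :=
  foldr (fun p r => if (p.1.1 == u) && (p.1.2 == v) then p.2 else r) 0 m.

Definition tab1 (V : seq nat) (f : nat -> nat) : seq (nat * nat) :=
  [seq (u, f u) | u <- V].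

Definition tab2 (V : seq nat) (f : nat -> nat -> nat) : seq (nat * nat * nat) :=
  [seq (u, v, f u v) | u <- V, v <- V].

(* Capping by a fixed table keeps the iterated tables of polynomial size. *)
Definition clamp1 V (c : seq (nat * nat)) f := tab1 V (fun u => minn (get1 c u) (f u)).
Definition clamp2 V (A : seq (nat * nat * nat)) f :=
  tab2 V (fun u v => minn (get2 A u v) (f u v)).

Ltac pt_hyp :=
  match goal with
  | H : ptime ?g |- ptime (fun a => ?g (@?f a)) =>
      simple apply (@ptime_comp _ _ _ _ _ _ f g H)
  end.
Ltac pt_extra ::= first [pt_arith | pt_hyp].

Lemma ptime_get1 X (cX : coded X) (m : X -> seq (nat * nat)) (u : X -> nat) :
  ptime m -> ptime u -> ptime (fun x => get1 (m x) (u x)).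
Proof.
move=> pm pu; apply: (ptime_foldr_additive
  (h := fun x (p : nat * nat) r => if p.1 == u x then p.2 else r) (b := fun _ => 0)
  (q := fun p => sz p)) => //; [by pt|by pt|by pb|].
by move=> x r [k v]; rewrite !sz_pair; case: ifP => _ /=; lia.
Qed.

Lemma ptime_get2 X (cX : coded X) (m : X -> seq (nat * nat * nat)) (u v : X -> nat) :
  ptime m -> ptime u -> ptime v -> ptime (fun x => get2 (m x) (u x) (v x)).
Proof.
move=> pm pu pv; apply: (ptime_foldr_additive
  (h := fun x (p : nat * nat * nat) r => if (p.1.1 == u x) && (p.1.2 == v x) then p.2 else r)
  (b := fun _ => 0) (q := fun p => sz p)) => //; [by pt|by pt|by pb|].
by move=> x r [k w]; rewrite !sz_pair; case: ifP => _ /=; lia.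
Qed.

(** The factor 2 is there because the code of [true] is longer than that of [false], so a smaller
    number may have a longer code. *)
Lemma sz_nat_le m n : m <= n -> sz m < 2 * sz n.
Proof.
move=> /blen_mono; have /andP [_ h1] := sz_nat m; have /andP [h2 _] := sz_nat n; lia.
Qed.

Lemma sz_clamp1 V c f : sz (clamp1 V c f) < 2 * sz (tab1 V (get1 c)).
Proof.
rewrite /clamp1 /tab1; elim: V => //= u V IH; rewrite !sz_cons !sz_pair.
by have := sz_nat_le (geq_minl (get1 c u) (f u)); lia.
Qed.

Lemma sz_map_le S T (cT : coded T) (f g : S -> T) (l : seq S) :
  (forall a, sz (f a) < 2 * sz (g a)) -> sz (map f l) < 2 * sz (map g l).
Proof. by move=> h; elim: l => //= a l IH; rewrite !sz_cons; have := h a; lia. Qed.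

Lemma sz_clamp2 V A f : sz (clamp2 V A f) < 2 * sz (tab2 V (get2 A)).
Proof.
rewrite /clamp2 /tab2; elim: {2 4}V => //= u U IH.
set l1 := map _ V; set l2 := flatten _ in IH *; set l3 := map _ V; set l4 := flatten _ in IH *.
have : sz l1 < 2 * sz l3.
  by apply: sz_map_le => v; rewrite !sz_pair; have := sz_nat_le (geq_minl (get2 A u v) (f u v)); lia.
have e1 : (sz (l1 ++ l2)).+1 = sz l1 + sz l2 by apply: sz_cat.
have e2 : (sz (l3 ++ l4)).+1 = sz l3 + sz l4 by apply: sz_cat.
have : 0 < sz l2 by apply: sz_gt0.
lia.
Qed.

Lemma get1_map (T : eqType) (k : T -> nat) (f : T -> nat) s u : injective k ->
  get1 [seq (k v, f v) | v <- s] (k u) = if u \in s then f u else 0.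
Proof.
move=> inj_k; elim: s => //= v s ->; rewrite inE (inj_eq inj_k) [u == v]eq_sym.
by case: eqP => //= ->.
Qed.

Lemma get2_map (T : eqType) (k : T -> nat) (f : T -> T -> nat) s t u v : injective k ->
  get2 [seq (k i, k j, f i j) | i <- s, j <- t] (k u) (k v) =
  if (u \in s) && (v \in t) then f u v else 0.
Proof.
move=> inj_k.
have row w r : foldr (fun (p : nat * nat * nat) r =>
      if (p.1.1 == k u) && (p.1.2 == k v) then p.2 else r)
    r [seq (k w, k z, f w z) | z <- t] = if (w == u) && (v \in t) then f u v else r.
  elim: t => [|z t /= ->]; rewrite ?andbF // inE !(inj_eq inj_k) [v == z]eq_sym.
  by case: eqP => //= ->; case: eqP => //= ->.
elim: s => //= w s IH; rewrite /get2 foldr_cat -/(get2 _ _ _) IH row inE.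
by rewrite [u == w]eq_sym; case: eqP => //= _; case: (v \in t); rewrite ?andbF.
Qed.

Lemma get1_tab V f u : get1 (tab1 V f) u = if u \in V then f u else 0.
Proof. exact: (@get1_map _ id). Qed.

Lemma get2_tab V f u v : get2 (tab2 V f) u v = if (u \in V) && (v \in V) then f u v else 0.
Proof. exact: (@get2_map _ id). Qed.

(** * The algorithm *)

(** [get2 F u v] is the part of the demand of the edge uv that is charged to [u], and [get2 F v u]
    the part charged to [v]. *)
Definition load V F u := sumn [seq get2 F u v | v <- V].

Definition overfull V cap F u := get1 cap u < load V F u.
Definition underfull V cap F u := load V F u < get1 cap u.

Definition key (l : seq (nat * nat)) u := has (fun p => p.1 == u) l.

(* An entry (u, v) records that from u one can move on to v; an entry (u, u)
   that u can take one more unit itself. *)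
Definition grow F (l : seq (nat * nat)) (e : nat * nat) :=
  if ~~ key l e.1 && key l e.2 && (0 < get2 F e.1 e.2) then e :: l else l.

(** As many sweeps over all pairs as there are vertices: a sweep that adds nothing has reached the
    fixed point, and each vertex is entered at most once. *)
Definition search V cap F :=
  foldl (grow F) [seq (u, u) | u <- V & underfull V cap F u]
    (flatten [seq [seq (u, v) | u <- V, v <- V] | _ <- V]).

(** One unit of the demand of the edge is moved from the account of [e.1] to that of [e.2]. The cap
    is inactive as long as F splits A and the unit is there to be moved. *)
Definition push V A F (e : nat * nat) :=
  clamp2 V A (fun i j =>
    if (i == e.1) && (j == e.2) then get2 F i j - 1
    else if (i == e.2) && (j == e.1) then get2 F i j + 1 else get2 F i j).

(** The latest entry of the search list comes first and leads to a vertex entered earlier, so a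
    single pass over the list follows a path down to its root. *)
Definition walk V A (st : nat * seq (nat * nat * nat)) (e : nat * nat) :=
  if e.1 == st.1 then (e.2, push V A st.2 e) else st.

Definition starts V cap F (l : seq (nat * nat)) :=
  [seq u <- V | overfull V cap F u && key l u].

Definition augment V A cap F :=
  let l := search V cap F in
  let s := starts V cap F l in
  if nilp s then F else (foldl (walk V A) (head 0 s, F) l).2.

(* The doubled solution of the halved problem, the odd units going to the
   smaller end. *)
Definition refine V A F :=
  clamp2 V A (fun i j => get2 F i j + get2 F i j +
    (if i < j then (if odd (get2 A i j) then 1 else 0) else 0)).

(* The list only provides fuel: its length bounds the total excess of [refine]. *)
Definition balance V A cap F :=
  foldl (fun F' (_ : nat) => augment V A cap F') (refine V A F)
    (flatten [seq 0 :: V | _ <- V]).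

(** The empty list stands for success. No confusion arises: when no augmenting path exists, an
    overloaded vertex belongs to the list itself. *)
Definition stuck V cap F :=
  if has (overfull V cap F) V
  then [seq u <- V | ~~ key (search V cap F) u] else [::].

Definition phase V (st : seq nat * seq (nat * nat * nat))
    (lev : seq (nat * nat * nat) * seq (nat * nat)) :=
  if nilp st.1 then
    let F := balance V lev.1 lev.2 st.2 in (stuck V lev.2 F, F)
  else st.

Definition halve V A0 cap0 (lev : seq (nat * nat * nat) * seq (nat * nat)) :=
  (clamp2 V A0 (fun i j => (get2 lev.1 i j)./2),
   clamp1 V cap0 (fun u => (get1 lev.2 u + 1)./2)).

(* The coarsest level comes first. *)
Definition levels V A cap (fuel : seq bool) :=
  foldl (fun acc (_ : bool) => halve V A cap (head (A, cap) acc) :: acc) [:: (A, cap)] fuel.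

Definition solve V A cap fuel :=
  (foldl (phase V) ([::], [::]) (levels V A cap fuel)).1.

(** * Polynomial running time of the flow algorithm *)

Notation mat := (seq (nat * nat * nat)) (only parsing).
Notation vec := (seq (nat * nat)) (only parsing).

Ltac pt_table := match goal with
  | |- ptime (fun x => get1 (@?f x) (@?u x)) => simple apply (@ptime_get1 _ _ f u)
  | |- ptime (fun x => get2 (@?f x) (@?u x) (@?v x)) => simple apply (@ptime_get2 _ _ f u v)
  | |- ptime (fun x => sumn (@?l x)) => simple apply (@ptime_sumn _ _ l)
  end.
Ltac pt_base := first [pt_arith | pt_table | pt_hyp].
Ltac pt_extra ::= pt_base.

Lemma ptime_clamp1 X (cX : coded X) (V : X -> seq nat) (c : X -> vec) (f : X -> nat -> nat) :
  ptime V -> ptime c -> ptime (fun p => f p.1 p.2) ->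
  ptime (fun x => clamp1 (V x) (c x) (f x)).
Proof. by move=> pV pc pf; rewrite /clamp1 /tab1; pt. Qed.

Lemma ptime_clamp2 X (cX : coded X) (V : X -> seq nat) (A : X -> mat) (f : X -> nat -> nat -> nat) :
  ptime V -> ptime A -> ptime (fun p => f p.1.1 p.1.2 p.2) ->
  ptime (fun x => clamp2 (V x) (A x) (f x)).
Proof. by move=> pV pA pf; rewrite /clamp2 /tab2; pt. Qed.

Lemma ptime_load X (cX : coded X) (V : X -> seq nat) (F : X -> mat) (u : X -> nat) :
  ptime V -> ptime F -> ptime u -> ptime (fun x => load (V x) (F x) (u x)).
Proof. by move=> pV pF pu; rewrite /load; pt. Qed.

Ltac pt_clamp := match goal with
  | |- ptime (fun x => clamp1 (@?V x) (@?c x) (@?f x)) =>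
       simple apply (@ptime_clamp1 _ _ V c f); cbv beta
  | |- ptime (fun x => clamp2 (@?V x) (@?c x) (@?f x)) =>
       simple apply (@ptime_clamp2 _ _ V c f); cbv beta
  | |- ptime (fun x => load (@?V x) (@?F x) (@?u x)) => simple apply (@ptime_load _ _ V F u)
  end.
Ltac pt_extra ::= first [pt_base | pt_clamp].

Lemma ptime_overfull X (cX : coded X) (V : X -> seq nat) (cap : X -> vec)
    (F : X -> mat) (u : X -> nat) :
  ptime V -> ptime cap -> ptime F -> ptime u ->
  ptime (fun x => overfull (V x) (cap x) (F x) (u x)).
Proof. by move=> *; rewrite /overfull; pt. Qed.

Lemma ptime_underfull X (cX : coded X) (V : X -> seq nat) (cap : X -> vec)
    (F : X -> mat) (u : X -> nat) :
  ptime V -> ptime cap -> ptime F -> ptime u ->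
  ptime (fun x => underfull (V x) (cap x) (F x) (u x)).
Proof. by move=> *; rewrite /underfull; pt. Qed.

Lemma ptime_key X (cX : coded X) (l : X -> vec) (u : X -> nat) :
  ptime l -> ptime u -> ptime (fun x => key (l x) (u x)).
Proof. by move=> *; rewrite /key; pt. Qed.

Ltac pt_pred := match goal with
  | |- ptime (fun x => overfull (@?V x) (@?c x) (@?F x) (@?u x)) => simple apply (@ptime_overfull _ _ V c F u)
  | |- ptime (fun x => underfull (@?V x) (@?c x) (@?F x) (@?u x)) => simple apply (@ptime_underfull _ _ V c F u)
  | |- ptime (fun x => key (@?l x) (@?u x)) => simple apply (@ptime_key _ _ l u)
  end.
Ltac pt_extra ::= first [pt_base | pt_clamp | pt_pred].

Lemma ptime_search X (cX : coded X) (V : X -> seq nat) (cap : X -> vec) (F : X -> mat) :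
  ptime V -> ptime cap -> ptime F -> ptime (fun x => search (V x) (cap x) (F x)).
Proof.
move=> pV pcap pF; rewrite /search.
apply: (ptime_foldl_additive (h := fun x => grow (F x)) (q := fun p => sz p)).
- by rewrite /grow; pt.
- by pt.
- by pt.
- by pb.
by move=> x r e; rewrite /grow sz_pair; case: ifP => _; rewrite ?sz_cons; lia.
Qed.

Lemma ptime_sz_clamp2 X (cX : coded X) (V : X -> seq nat) (A : X -> mat) :
  ptime V -> ptime A -> pbounded (fun x => 2 * sz (tab2 (V x) (get2 (A x)))).
Proof. by move=> pV pA; pb; apply: ptime_sz; rewrite /tab2; pt. Qed.

Lemma ptime_push X (cX : coded X) (V : X -> seq nat) (A F : X -> mat) (e : X -> nat * nat) :
  ptime V -> ptime A -> ptime F -> ptime e -> ptime (fun x => push (V x) (A x) (F x) (e x)).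
Proof. by move=> *; rewrite /push; pt. Qed.

Ltac pt_search := match goal with
  | |- ptime (fun x => search (@?V x) (@?c x) (@?F x)) => simple apply (@ptime_search _ _ V c F)
  | |- ptime (fun x => push (@?V x) (@?A x) (@?F x) (@?e x)) => simple apply (@ptime_push _ _ V A F e)
  end.
Ltac pt_extra ::= first [pt_base | pt_clamp | pt_pred | pt_search].

Lemma ptime_augment X (cX : coded X) (V : X -> seq nat) (A : X -> mat) (cap : X -> vec)
    (F : X -> mat) :
  ptime V -> ptime A -> ptime cap -> ptime F ->
  ptime (fun x => augment (V x) (A x) (cap x) (F x)).
Proof.
move=> pV pA pcap pF; rewrite /augment.
have ps : ptime (fun x => starts (V x) (cap x) (F x) (search (V x) (cap x) (F x))).
  by rewrite /starts; pt.
apply: ptime_if; [by pt | by [] |]; apply: ptime_app2.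
apply: (ptime_foldl_max (h := fun x => walk (V x) (A x))
  (b := fun x => (head 0 (starts (V x) (cap x) (F x) (search (V x) (cap x) (F x))), F x))
  (q := fun p => sz p + 2 * sz (tab2 (V p.1) (get2 (A p.1))) + 1)).
- by rewrite /walk; pt.
- by pt.
- by pt.
- by apply: pbounded_add; [apply: pbounded_add; [pb | apply: ptime_sz_clamp2; pt] | pb].
move=> x [u F'] [i j]; rewrite /walk; case: ifP => _; last exact: leq_maxl.
apply: leq_trans (leq_maxr _ _); rewrite !sz_pair /=.
have /= := sz_clamp2 (V x) (A x) (fun i0 j0 =>
    if (i0 == i) && (j0 == j) then get2 F' i0 j0 - 1
    else if (i0 == j) && (j0 == i) then get2 F' i0 j0 + 1 else get2 F' i0 j0).
rewrite /push /=; lia.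
Qed.

Lemma sz_augment V A cap F : sz (augment V A cap F) <= maxn (sz F) (2 * sz (tab2 V (get2 A))).
Proof.
rewrite /augment; case: ifP => _; first exact: leq_maxl.
move: (head _ _) => u; elim/last_ind: (search _ _ _) => [|l e IH]; first exact: leq_maxl.
rewrite foldl_rcons {1}/walk; case: ifP => _ //=.
by apply: leq_trans (leq_maxr _ _); apply: ltnW; apply: sz_clamp2.
Qed.

Lemma ptime_balance X (cX : coded X) (V : X -> seq nat) (A : X -> mat) (cap : X -> vec)
    (F : X -> mat) :
  ptime V -> ptime A -> ptime cap -> ptime F ->
  ptime (fun x => balance (V x) (A x) (cap x) (F x)).
Proof.
move=> pV pA pcap pF; rewrite /balance.
apply: (ptime_foldl_max (h := fun x F' _ => augment (V x) (A x) (cap x) F')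
  (b := fun x => refine (V x) (A x) (F x))
  (q := fun p => 2 * sz (tab2 (V p.1) (get2 (A p.1))))).
- by apply: ptime_augment; pt.
- by rewrite /refine; pt.
- by pt.
- by apply: ptime_sz_clamp2; pt.
by move=> x F' a; apply: sz_augment.
Qed.

Lemma sz_balance V A cap F : sz (balance V A cap F) <= 2 * sz (tab2 V (get2 A)).
Proof.
rewrite /balance; elim/last_ind: (flatten _) => [|l e IH] /=.
  by apply: ltnW; apply: sz_clamp2.
by rewrite foldl_rcons; apply: leq_trans (sz_augment _ _ _ _) _; rewrite geq_max IH /=.
Qed.

Lemma ptime_stuck X (cX : coded X) (V : X -> seq nat) (cap : X -> vec) (F : X -> mat) :
  ptime V -> ptime cap -> ptime F -> ptime (fun x => stuck (V x) (cap x) (F x)).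
Proof. by move=> *; rewrite /stuck; pt. Qed.

Lemma sz_filter A (cA : coded A) (a : pred A) (l : seq A) : sz (filter a l) <= sz l.
Proof. by elim: l => //= x l IH; case: ifP => _; rewrite !sz_cons; lia. Qed.

Lemma sz_stuck V cap F : sz (stuck V cap F) <= sz V.
Proof. by rewrite /stuck; case: ifP => _; [apply: sz_filter | apply: sz_gt0]. Qed.

Lemma ptime_levels X (cX : coded X) (V : X -> seq nat) (A : X -> mat) (cap : X -> vec)
    (fuel : X -> seq bool) :
  ptime V -> ptime A -> ptime cap -> ptime fuel ->
  ptime (fun x => levels (V x) (A x) (cap x) (fuel x)).
Proof.
move=> pV pA pcap pfuel; rewrite /levels.
apply: (ptime_foldl_additive
  (h := fun x (acc : seq (mat * vec)) (_ : bool) => halve (V x) (A x) (cap x) (head (A x, cap x) acc) :: acc)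
  (b := fun x => [:: (A x, cap x)])
  (q := fun p => 2 * sz (tab2 (V p.1) (get2 (A p.1))) + 2 * sz (tab1 (V p.1) (get1 (cap p.1))) + 2)).
- by rewrite /halve; pt.
- by pt.
- by pt.
- apply: pbounded_add; last by pb.
  apply: pbounded_add; first by apply: ptime_sz_clamp2; pt.
  by pb; apply: ptime_sz; rewrite /tab1; pt.
move=> x acc b; rewrite sz_cons sz_pair /=.
set lev := head _ _.
have := sz_clamp2 (V x) (A x) (fun i j => (get2 lev.1 i j)./2).
have := sz_clamp1 (V x) (cap x) (fun u => (get1 lev.2 u + 1)./2).
lia.
Qed.

Lemma ptime_solve X (cX : coded X) (V : X -> seq nat) (A : X -> mat) (cap : X -> vec)
    (fuel : X -> seq bool) :
  ptime V -> ptime A -> ptime cap -> ptime fuel ->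
  ptime (fun x => solve (V x) (A x) (cap x) (fuel x)).
Proof.
move=> pV pA pcap pfuel; rewrite /solve; apply: ptime_app1.
apply: (ptime_foldl_max (h := fun x => phase (V x)) (b := fun _ => ([::], [::]))
  (q := fun p => sz (V p.1) + 2 * sz (tab2 (V p.1) (get2 p.2.1)) + 1)).
- rewrite /phase; apply: ptime_if; first by pt.
    by apply: ptime_pair; [apply: ptime_stuck|]; try apply: ptime_balance; pt.
  by pt.
- by pt.
- exact: ptime_levels.
- apply: pbounded_add; last by pb.
  apply: pbounded_add; last by apply: ptime_sz_clamp2; pt.
  by apply: ptime_sz; pt.
move=> x [S F] [A' cap'] /=; rewrite /phase /=; case: ifP => _; last exact: leq_maxl.
apply: leq_trans (leq_maxr _ _); rewrite sz_pair.
have := sz_stuck (V x) cap' (balance (V x) A' cap' F).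
have := sz_balance (V x) A' cap' F; rewrite /=; lia.
Qed.

(** * From the encoded instance to the encoded answer *)

Definition enumerate A (l : seq A) : seq (nat * A) := zip (iota 0 (size l)) l.

Lemma enumerate_rcons A (l : seq A) a :
  enumerate (rcons l a) = rcons (enumerate l) (size l, a).
Proof.
rewrite /enumerate size_rcons -addn1 iotaD cats1 add0n zip_rcons //.
by rewrite size_iota.
Qed.

Lemma sz_rcons A {cA : coded A} (l : seq A) a : sz (rcons l a) = sz l + sz a + 1.
Proof.
rewrite -cats1; have := @sz_cat _ cA l [:: a]; rewrite sz_cons sz_nil; lia.
Qed.

Lemma sz_nat_lin n : sz n <= 4 * n + 1.
Proof.
have /andP [_] := sz_nat n; have : blen n <= n by rewrite blen_le ltn_expl.
lia.
Qed.

Lemma sz_enumerate A {cA : coded A} (l : seq A) :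
  sz (enumerate l) <= size l * (4 * size l + 4) + sz l.
Proof.
elim/last_ind: l => // l a IH; rewrite enumerate_rcons !sz_rcons size_rcons sz_pair.
by have := sz_nat_lin (size l); nia.
Qed.

Lemma ptime_enumerate X A (cX : coded X) (cA : coded A) (l : X -> seq A) :
  ptime l -> ptime (fun x => enumerate (l x)).
Proof.
move=> pl.
pose st (s : seq A) :=
  foldl (fun (st : nat * seq (nat * A)) a => (st.1 + 1, (st.1, a) :: st.2)) (0, [::]) s.
have st_eq s : st s = (size s, rev (enumerate s)).
  elim/last_ind: s => // s a IH; rewrite /st foldl_rcons -/(st s) IH /=.
  by rewrite enumerate_rcons rev_rcons size_rcons addn1.
apply: (ptime_ext (f := fun x => rev (st (l x)).2)); last first.
  by move=> x; rewrite st_eq revK.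
apply: ptime_rev; apply: ptime_app2.
apply: (ptime_foldl (h := fun _ (st : nat * seq (nat * A)) a => (st.1 + 1, (st.1, a) :: st.2))
   (b := fun _ => (0, [::]))
   (q := fun x => 4 * sz (l x) + 2 + (sz (l x) * (4 * sz (l x) + 4) + sz (l x)))).
- by pt.
- by pt.
- by [].
- by pb; apply: ptime_sz.
move=> x l1 l2 eq_l; rewrite -/(st l1) st_eq sz_pair sz_rev.
have := sz_nat_lin (size l1); have := @sz_enumerate _ cA l1.
have := @sz_cat _ cA l1 l2; rewrite -eq_l; have := @sz_gt0 _ (coded_seq cA) l2.
have := @size_le_sz _ cA l1; nia.
Qed.

(** Arranged so that its code is literally the given encoding ([word_instance]): rows of the matrix,
    then sign, absolute numerator and denominator of each coordinate. *)
Definition instance : Type := (seq (seq bool) * seq (bool * nat * nat))%type.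

Definition vertices (I : instance) := [seq p.1 | p <- enumerate I.1].
Definition adjacency (I : instance) : mat :=
  [seq (p.1, q.1, if q.2 then 1 else 0) | p <- enumerate I.1, q <- enumerate p.2].
Definition signs (I : instance) : vec := [seq (p.1, if p.2.1.1 then 1 else 0) | p <- enumerate I.2].
Definition nums (I : instance) : vec := [seq (p.1, p.2.1.2) | p <- enumerate I.2].
Definition dens (I : instance) : vec := [seq (p.1, p.2.2) | p <- enumerate I.2].

Definition scale (I : instance) := foldr muln 1 [seq get1 (dens I) v | v <- vertices I].

(** For 0 <= x u <= 1 this is [scale I] times 1 - x u; leaving the denominator of [u] out of the
    product avoids a division. *)
Definition weight (I : instance) (u : nat) :=
  (get1 (dens I) u - get1 (nums I) u) *
  foldr muln 1 [seq get1 (dens I) v | v <- vertices I & ~~ (v == u)].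

(* Truncated subtraction: the demand of an edge uv is max(0, w(u) + w(v) - 1), scaled. *)
Definition demand (I : instance) : mat :=
  tab2 (vertices I) (fun i j =>
    if 0 < get2 (adjacency I) i j then weight I i + weight I j - scale I else 0).

(** It bounds every single demand, so its bit length is a sufficient number of halvings. *)
Definition total (I : instance) := sumn [seq p.2 | p <- demand I].

(* The edge [e] is forced into the violated set; its ends then cost nothing more. *)
Definition demand_off (I : instance) (e : nat * nat) : mat :=
  tab2 (vertices I) (fun i j =>
    if (i == e.1) && (j == e.2) || (i == e.2) && (j == e.1) then 0
    else get2 (demand I) i j).

Definition capacity (I : instance) (e : nat * nat) : vec :=
  tab1 (vertices I) (fun u => if (u == e.1) || (u == e.2) then 0 else weight I u).

Definition edge_list (I : instance) := [seq p.1 | p <- adjacency I & 0 < p.2].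

(** The adjacency matrix of [witness_set]; membership is spelled with [has], for which [pt] has a
    rule. *)
Definition witness (I : instance) (e : nat * nat) (S : seq nat) : seq (seq bool) :=
  [seq [seq has (fun k => k == i) S && has (fun k => k == j) S && (0 < get2 (demand_off I e) i j)
        || ((i == e.1) && (j == e.2) || (i == e.2) && (j == e.1))
       | j <- vertices I] | i <- vertices I].

Definition solve_edge (I : instance) (e : nat * nat) :=
  solve (vertices I) (demand_off I e) (capacity I e) (bits_of_nat (total I)).

Definition violation (I : instance) : seq (seq bool) :=
  foldl (fun acc e => if nilp acc then
      (if nilp (solve_edge I e) then [::] else witness I e (solve_edge I e))
    else acc) [::] (edge_list I).

Definition negatives (I : instance) := [seq u <- vertices I | 0 < get1 (signs I) u].
Definition exceeding (I : instance) :=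
  [seq u <- vertices I | get1 (dens I) u < get1 (nums I) u].

Definition node S T {cS : coded S} {cT : coded T} (a : S) (b : T) : tree :=
  Node (code a) (code b).

(** The order matters: [exceeding] compares absolute values and is right once x >= 0 is known, and
    [weight] is right once both bounds are known. *)
Definition answer (I : instance) : tree :=
  if ~~ nilp (negatives I) then node 0 (head 0 (negatives I))
  else if ~~ nilp (exceeding I) then node 1 (head 0 (exceeding I))
  else if nilp (violation I) then Leaf else node 2 (violation I).

#[global] Instance coded_instance : coded instance :=
  coded_prod (coded_seq (coded_seq coded_bool))
    (coded_seq (coded_prod (coded_prod coded_bool coded_nat) coded_nat)).

Lemma ptime_node X S T (cX : coded X) (cS : coded S) (cT : coded T) (f : X -> S) (g : X -> T) :
  ptime f -> ptime g -> ptime (fun x => node (f x) (g x)).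
Proof. by move=> pf pg; apply: ptime_recode (ptime_pair pf pg) _. Qed.

Ltac pt_more := match goal with
  | |- ptime (fun x => enumerate (@?l x)) => simple apply (@ptime_enumerate _ _ _ _ l)
  | |- ptime (fun x => @?f x * @?g x) => simple apply (@ptime_mul _ _ f g)
  | |- ptime (fun x => foldr muln 1 (@?l x)) => simple apply (@ptime_prodn _ _ l)
  | |- ptime (fun x => bits_of_nat (@?l x)) => simple apply (@ptime_bits _ _ l)
  end.
Ltac pt_extra ::= first [pt_base | pt_clamp | pt_pred | pt_search | pt_more].

Lemma ptime_vertices : ptime vertices.
Proof. rewrite /vertices; pt. Qed.

Lemma ptime_adjacency : ptime adjacency.
Proof. rewrite /adjacency; pt. Qed.

Lemma ptime_signs : ptime signs.
Proof. rewrite /signs; pt. Qed.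

Lemma ptime_nums : ptime nums.
Proof. rewrite /nums; pt. Qed.

Lemma ptime_dens : ptime dens.
Proof. rewrite /dens; pt. Qed.

Ltac pt_inst := match goal with
  | |- ptime vertices => exact: ptime_vertices
  | |- ptime (fun x => vertices (@?f x)) => simple apply (@ptime_comp _ _ _ _ _ _ f _ ptime_vertices)
  | |- ptime adjacency => exact: ptime_adjacency
  | |- ptime (fun x => adjacency (@?f x)) => simple apply (@ptime_comp _ _ _ _ _ _ f _ ptime_adjacency)
  | |- ptime signs => exact: ptime_signs
  | |- ptime (fun x => signs (@?f x)) => simple apply (@ptime_comp _ _ _ _ _ _ f _ ptime_signs)
  | |- ptime nums => exact: ptime_nums
  | |- ptime (fun x => nums (@?f x)) => simple apply (@ptime_comp _ _ _ _ _ _ f _ ptime_nums)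
  | |- ptime dens => exact: ptime_dens
  | |- ptime (fun x => dens (@?f x)) => simple apply (@ptime_comp _ _ _ _ _ _ f _ ptime_dens)
  end.
Ltac pt_extra ::= first [pt_base | pt_clamp | pt_pred | pt_search | pt_more | pt_inst].

Lemma ptime_scale : ptime scale.
Proof. rewrite /scale; pt. Qed.

Lemma ptime_weight X (cX : coded X) (f : X -> instance) (u : X -> nat) :
  ptime f -> ptime u -> ptime (fun x => weight (f x) (u x)).
Proof. by move=> pf pu; rewrite /weight; pt. Qed.

Ltac pt_weight := match goal with
  | |- ptime scale => exact: ptime_scale
  | |- ptime (fun x => scale (@?f x)) => simple apply (@ptime_comp _ _ _ _ _ _ f _ ptime_scale)
  | |- ptime (fun x => weight (@?f x) (@?u x)) => simple apply (@ptime_weight _ _ f u)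
  end.
Ltac pt_extra ::=
  first [pt_base | pt_clamp | pt_pred | pt_search | pt_more | pt_inst | pt_weight].

Lemma ptime_demand : ptime demand.
Proof. rewrite /demand /tab2; pt. Qed.

Lemma ptime_total : ptime total.
Proof. rewrite /total; pt; exact: ptime_demand. Qed.

Lemma ptime_demand_off X (cX : coded X) (f : X -> instance) (e : X -> nat * nat) :
  ptime f -> ptime e -> ptime (fun x => demand_off (f x) (e x)).
Proof.
move=> pf pe; rewrite /demand_off /tab2; pt.
by apply: (ptime_comp ptime_demand); pt.
Qed.

Lemma ptime_capacity X (cX : coded X) (f : X -> instance) (e : X -> nat * nat) :
  ptime f -> ptime e -> ptime (fun x => capacity (f x) (e x)).
Proof. by move=> pf pe; rewrite /capacity /tab1; pt. Qed.

Lemma ptime_edge_list : ptime edge_list.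
Proof. rewrite /edge_list; pt. Qed.

Ltac pt_demand := match goal with
  | |- ptime demand => exact: ptime_demand
  | |- ptime (fun x => demand (@?f x)) => simple apply (@ptime_comp _ _ _ _ _ _ f _ ptime_demand)
  | |- ptime total => exact: ptime_total
  | |- ptime (fun x => total (@?f x)) => simple apply (@ptime_comp _ _ _ _ _ _ f _ ptime_total)
  | |- ptime edge_list => exact: ptime_edge_list
  | |- ptime (fun x => edge_list (@?f x)) => simple apply (@ptime_comp _ _ _ _ _ _ f _ ptime_edge_list)
  | |- ptime (fun x => capacity (@?f x) (@?u x)) => simple apply (@ptime_capacity _ _ f u)
  | |- ptime (fun x => demand_off (@?f x) (@?u x)) => simple apply (@ptime_demand_off _ _ f u)
  end.
Ltac pt_extra ::=
  first [pt_base | pt_clamp | pt_pred | pt_search | pt_more | pt_inst | pt_weight | pt_demand].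

Lemma ptime_witness X (cX : coded X) (f : X -> instance) (e : X -> nat * nat) (S : X -> seq nat) :
  ptime f -> ptime e -> ptime S -> ptime (fun x => witness (f x) (e x) (S x)).
Proof. by move=> pf pe pS; rewrite /witness; pt. Qed.

Lemma ptime_solve_edge X (cX : coded X) (f : X -> instance) (e : X -> nat * nat) :
  ptime f -> ptime e -> ptime (fun x => solve_edge (f x) (e x)).
Proof. by move=> pf pe; rewrite /solve_edge; apply: ptime_solve; pt. Qed.

Lemma ptime_violation : ptime violation.
Proof.
have pw : ptime (fun p : instance * (nat * nat) => witness p.1 p.2 (solve_edge p.1 p.2)).
  by apply: ptime_witness; try apply: ptime_solve_edge; pt.
rewrite /violation.
apply: (ptime_foldl_max (h := fun I acc e => if nilp acc then
      (if nilp (solve_edge I e) then [::] else witness I e (solve_edge I e))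
    else acc) (b := fun _ => [::])
  (q := fun p => sz (witness p.1 p.2 (solve_edge p.1 p.2)))).
- apply: ptime_if; [by pt | apply: ptime_if | by pt].
  + by pt; apply: ptime_solve_edge; pt.
  + by pt.
  + by apply: ptime_witness; try apply: ptime_solve_edge; pt.
- by pt.
- by pt.
- exact: ptime_sz pw.
move=> I acc e; case: ifP => _; last exact: leq_maxl.
case: ifP => _; last exact: leq_maxr.
by rewrite leq_max sz_gt0.
Qed.

Lemma ptime_answer : ptime answer.
Proof.
have pn : ptime negatives by rewrite /negatives; pt.
have pe : ptime exceeding by rewrite /exceeding; pt.
have pv := ptime_violation.
rewrite /answer; apply: ptime_if; [by pt | by apply: ptime_node; pt |].
apply: ptime_if; [by pt | by apply: ptime_node; pt |].
by apply: ptime_if; [by pt | by pt |]; apply: ptime_node; pt.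
Qed.

(** * Correctness of the flow computation *)

(** Replaces a termination test, both for the sweeps of the search and for the augmentations: it
    suffices that the number of rounds bounds the initial potential. *)
Lemma iter_stable T (P : T -> Prop) (f : T -> T) (m : T -> nat) N x :
  (forall y, P y -> P (f y) /\ (f y = y \/ m (f y) < m y)) ->
  P x -> m x <= N -> P (iter N f x) /\ f (iter N f x) = iter N f x.
Proof.
move=> h; elim: N x => [|N IH] x Px le_m.
  by split=> //=; have [_ [//|]] := h x Px; lia.
have [Pf [eq_f | lt_m]] := h x Px.
  have fixed k : iter k f x = x by elim: k => //= k ->.
  by rewrite !fixed.
by rewrite !iterSr; apply: IH => //; lia.
Qed.

Lemma foldl_const A B (f : B -> B) (s : seq A) z : foldl (fun r _ => f r) z s = iter (size s) f z.
Proof. by elim: s z => //= a s IH z; rewrite IH -iterSr. Qed.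

Lemma foldl_flatten A B (h : B -> A -> B) z (ss : seq (seq A)) :
  foldl h z (flatten ss) = foldl (fun r s => foldl h r s) z ss.
Proof. by elim: ss z => //= s ss IH z; rewrite foldl_cat IH. Qed.

Lemma keyE l u : key l u = (u \in map fst l).
Proof. by rewrite /key -has_pred1 has_map. Qed.

Section Flow.

Variables (V : seq nat) (A : seq (nat * nat * nat)) (cap : seq (nat * nat)).
Hypothesis uniq_V : uniq V.
Hypothesis A_diag : forall i, get2 A i i = 0.
Hypothesis A_sym : forall i j, i \in V -> j \in V -> get2 A i j = get2 A j i.

Definition splits (F : mat) : Prop :=
  forall i j, i \in V -> j \in V -> get2 F i j + get2 F j i = get2 A i j.

Lemma splits_diag F i : splits F -> i \in V -> get2 F i i = 0.
Proof. by move=> sF iV; have := sF i i iV iV; rewrite A_diag; lia. Qed.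

Lemma get2_clamp f i j : i \in V -> j \in V ->
  get2 (clamp2 V A f) i j = minn (get2 A i j) (f i j).
Proof. by move=> iV jV; rewrite get2_tab iV jV. Qed.

Lemma loadE F u : load V F u = \sum_(v <- V) get2 F u v.
Proof. by rewrite /load sumnE big_map. Qed.

(** A walk also pushes along the root entry [(u, u)] at its end; this is harmless because the
    diagonal demand is 0. *)
Lemma push_id F u i j : splits F -> u \in V -> i \in V -> j \in V ->
  get2 (push V A F (u, u)) i j = get2 F i j.
Proof.
move=> sF uV iV jV; rewrite get2_clamp //=; have := sF i j iV jV; have := splits_diag sF uV.
by case: ifP => [/andP [/eqP -> /eqP ->] -> | ->]; rewrite /=; lia.
Qed.

Section Push.

Variables (F : mat) (u v : nat).
Hypotheses (sF : splits F) (uV : u \in V) (vV : v \in V) (ne_uv : u != v).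
Hypothesis Fuv : 0 < get2 F u v.

(** Correction terms are added on both sides, here and in [load_push], to stay clear of truncated
    subtraction. *)
Lemma get2_push i j : i \in V -> j \in V ->
  get2 (push V A F (u, v)) i j + ((i == u) && (j == v)) =
  get2 F i j + ((i == v) && (j == u)).
Proof.
move=> iV jV; rewrite get2_clamp //=; have := sF iV jV.
case: (i =P u) => [->|_]; case: (j =P v) => [->|_] /=.
- by rewrite (negbTE ne_uv) /=; lia.
- by rewrite (negbTE ne_uv) /=; lia.
- by case: (i == v); rewrite [v == u]eq_sym (negbTE ne_uv) /=; lia.
case: (i =P v) => [->|_]; case: (j =P u) => [->|_] /=; lia.
Qed.

Lemma splits_push : splits (push V A F (u, v)).
Proof.
move=> i j iV jV; have := get2_push iV jV; have := get2_push jV iV; have := sF iV jV.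
rewrite [(j == u) && _]andbC [(j == v) && _]andbC; lia.
Qed.

Lemma load_push w : w \in V ->
  load V (push V A F (u, v)) w + (w == u) = load V F w + (w == v).
Proof.
move=> wV; rewrite !loadE.
have one z (b : bool) : z \in V -> \sum_(x <- V) (b && (x == z)) = b :> nat.
  move=> zV; rewrite (big_rem z) //= eqxx andbT big1_seq ?addn0 // => x.
  by rewrite rem_filter // mem_filter /= => /andP [/negbTE -> _]; rewrite andbF.
rewrite -(one v (w == u)) // -(one u (w == v)) // -!big_split /=.
by apply: eq_big_seq => x xV; apply: get2_push.
Qed.

End Push.

Section Chain.

Variable P : pred nat.

(** Invariant of the search list: keys are distinct, and every entry is either a root satisfying [P]
    or leads, along a unit that can be moved, to a key further down the list. *)
Fixpoint chain F (l : seq (nat * nat)) : bool :=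
  if l is e :: l' then
    [&& e.1 \in V, e.2 \in V, ~~ key l' e.1,
        if e.1 == e.2 then P e.1 else key l' e.2 && (0 < get2 F e.1 e.2) & chain F l']
  else true.

Lemma chain_mono F F' l :
  (forall i j, i \in V -> j \in V -> key l i -> 0 < get2 F i j -> 0 < get2 F' i j) ->
  chain F l -> chain F' l.
Proof.
elim: l => //= e l IH h /and5P [h1 h2 h3 h4 h5]; rewrite h1 h2 h3 /=; apply/andP; split.
  by move: h4; case: eqP => // _ /andP [-> h4] /=; apply: h => //; rewrite eqxx.
by apply: (IH _ h5) => i j iV jV kl; apply: h => //; rewrite kl orbT.
Qed.

Lemma chain_key F l i : chain F l -> key l i -> i \in V.
Proof.
by elim: l => //= e l IH /and5P [h1 _ _ _ h5] /orP [/eqP <- // | /IH]; apply.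
Qed.

Lemma chain_size F l : chain F l -> size l <= size V.
Proof.
move=> ch; rewrite -(size_map fst); apply: uniq_leq_size; last first.
  by move=> i; rewrite -keyE; apply: chain_key ch.
elim: l ch => //= e l IH /and5P [_ _ h3 _ /IH ->]; by rewrite andbT -keyE.
Qed.

Lemma walk_notkey l u F : ~~ key l u -> foldl (walk V A) (u, F) l = (u, F).
Proof.
elim: l => //= e l IH; rewrite negb_or => /andP [/negbTE ne /IH]; by rewrite /walk /= ne.
Qed.

(** Inner vertices of the path gain one unit and pass one on, so only the loads of the start and of
    the root change. *)
Lemma walk_spec l u F :
  splits F -> chain F l -> key l u ->
  let st := foldl (walk V A) (u, F) l in
  [/\ P st.1, st.1 \in V, splits st.2 &
      forall w, w \in V -> load V st.2 w + (w == u) = load V F w + (w == st.1)].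
Proof.
elim: l u F => //= e l IH u F sF /and5P [h1 h2 h3 h4 h5]; rewrite ![walk V A (u, F) e]/walk /=.
case: eqP => [eq_u _ | _ /= ku]; last exact: IH.
case: e => i j /= in h1 h2 h3 h4 eq_u *; subst u.
move: h4; case: eqP => [eq_j Pi | /eqP ne_ij /andP [kj Fij]].
  subst j; rewrite (walk_notkey _ h3) /=; split=> //.
    by move=> x y xV yV; rewrite !push_id //; apply: sF.
  move=> w wV; congr (_ + _); rewrite !loadE; apply: eq_big_seq => x xV.
  exact: push_id.
(* Only the entry of F at (i, j) decreases, and [i] is not a key of [l], so the rest of the path
   stays usable. *)
have ch' : chain (push V A F (i, j)) l.
  apply: chain_mono h5 => x y xV yV kx Fxy.
  have := get2_push sF h1 h2 ne_ij Fij xV yV.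
  by case: (x =P i) kx => [-> | _]; [rewrite (negbTE h3) | move=> _ /=; lia].
have [P1 V1 s1 eq1] := IH j _ (splits_push sF h1 h2 ne_ij Fij) ch' kj.
split=> // w wV; move: (eq1 w wV) (load_push sF h1 h2 ne_ij Fij wV).
by move: (nat_of_bool (w == i)) (nat_of_bool (w == j)) (nat_of_bool (w == _)) => a b c; clear; lia.
Qed.

Definition can_grow F l (e : nat * nat) := [&& ~~ key l e.1, key l e.2 & 0 < get2 F e.1 e.2].

Lemma grow_size F l e : size (grow F l e) = size l + can_grow F l e.
Proof. by rewrite /grow /can_grow andbA; case: ifP => _ /=; lia. Qed.

Lemma chain_grow F l e :
  chain F l -> e.1 \in V -> e.2 \in V -> chain F (grow F l e).
Proof.
move=> ch e1 e2; rewrite /grow; case: ifP => // /andP [/andP [k1 k2] Fe] /=.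
rewrite e1 e2 k1 k2 Fe ch /=; case: eqP => // eq_e.
by move: k1; rewrite eq_e k2.
Qed.

Lemma sweep_spec F l ps :
  (forall e, e \in ps -> e.1 \in V /\ e.2 \in V) -> chain F l ->
  chain F (foldl (grow F) l ps) /\
  (foldl (grow F) l ps = l /\ (forall e, e \in ps -> ~~ can_grow F l e) \/
   size l < size (foldl (grow F) l ps)).
Proof.
elim: ps l => [|e ps IH] l sub ch /=; first by split=> //; left.
have [e1 e2] := sub e (mem_head _ _).
have [|ch' h] := IH _ _ (chain_grow ch e1 e2).
  by move=> e' h'; apply: sub; rewrite inE h' orbT.
split=> //; case: h => [[-> h]|]; last by rewrite grow_size; right; lia.
case: (boolP (can_grow F l e)) => cg; first by right; rewrite grow_size cg; lia.
have eq_g : grow F l e = l by rewrite /grow -andbA -/(can_grow F l e) (negbTE cg).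
left; rewrite eq_g in h *; split=> // e'.
by rewrite inE => /orP [/eqP -> //|]; apply: h.
Qed.

End Chain.

Lemma key_foldl_grow F l ps i : key l i -> key (foldl (grow F) l ps) i.
Proof.
elim: ps l => //= e ps IH l kl; apply: IH; rewrite /grow; case: ifP => //= _.
by rewrite kl orbT.
Qed.

Lemma key_search F u : u \in V -> underfull V cap F u -> key (search V cap F) u.
Proof.
move=> uV un; apply: key_foldl_grow; rewrite keyE -map_comp map_id mem_filter.
by rewrite un.
Qed.

Lemma search_spec F (l := search V cap F) :
  chain (underfull V cap F) F l /\
  forall i j, i \in V -> j \in V -> key l j -> 0 < get2 F i j -> key l i.
Proof.
pose ps := [seq (u, v) | u <- V, v <- V].
have sub e : e \in ps -> e.1 \in V /\ e.2 \in V by case/allpairsP => -[x y] [/= xV yV ->].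
pose sweep l := foldl (grow F) l ps.
have -> : l = iter (size V) sweep [seq (u, u) | u <- V & underfull V cap F u].
  have rep (U : seq nat) z :
    foldl (fun r s => foldl (grow F) r s) z [seq ps | _ <- U] = iter (size U) sweep z.
    by elim: U z => //= x U IH z; rewrite IH -iterSr.
  by rewrite /l /search foldl_flatten rep.
(* The potential is the number of vertices not yet reached; distinct keys give
   [size l <= size V]. *)
have := @iter_stable _ (chain (underfull V cap F) F) sweep (fun l => size V - size l) (size V).
case/(_ [seq (u, u) | u <- V & underfull V cap F u]).
- move=> l' ch; have [ch' h] := sweep_spec sub ch; split=> //.
  case: h => [[eq_l _] | lt_s]; [by left | right].
  have := chain_size ch'; rewrite /sweep; lia.
- suff roots (U : seq nat) : uniq U -> {subset U <= V} ->
    chain (underfull V cap F) F [seq (u, u) | u <- U & underfull V cap F u] by apply: roots.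
  elim: U => //= u U IH /andP [uU uU'] sU.
  have subU : {subset U <= V} by move=> x xU; apply: sU; rewrite inE xU orbT.
  case: ifP => [un | _]; last exact: IH.
  rewrite /= sU ?mem_head // eqxx un IH // andbT keyE -map_comp map_id mem_filter.
  by rewrite (negbTE uU) andbF.
- by lia.
move=> ch fixed; split=> // i j iV jV kj Fij.
set l' := iter _ _ _ in ch fixed kj *.
have [_ [[_ h] | ]] := sweep_spec sub ch; last by rewrite -/(sweep _) fixed ltnn.
have /h : (i, j) \in ps by apply/allpairsP; exists (i, j).
by rewrite /can_grow kj Fij /=; case: (key l' i).
Qed.

Definition excess F := \sum_(u <- V) (load V F u - get1 cap u).

Lemma augment_spec F : splits F ->
  splits (augment V A cap F) /\
  (starts V cap F (search V cap F) = [::] /\ augment V A cap F = F \/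
   excess (augment V A cap F) < excess F).
Proof.
move=> sF; rewrite /augment.
have [ch _] := search_spec F; set l := search V cap F in ch *.
case E : (starts V cap F l) => [|s ss] /=; first by split=> //; left.
have : s \in starts V cap F l by rewrite E mem_head.
rewrite mem_filter => /andP [/andP [ov ks] sV].
have [un rV sF' eq_l] := walk_spec sF ch ks.
set st := foldl _ _ _ in un rV sF' eq_l *; split=> //; right.
(* The root is underfull and the start is overfull. Hence the start loses a unit of excess and the
   root absorbs it without creating any. *)
have ne : st.1 != s by apply/eqP => eq_s; move: un; rewrite eq_s /underfull ltnNge ltnW.
rewrite /excess (big_rem s) //= [X in _ < X](big_rem s) //= -addSn.
apply: leq_add.
  move: (eq_l s sV) ov; rewrite eqxx [s == _]eq_sym (negbTE ne) /overfull.
  by clear; lia.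
rewrite big_seq [X in _ <= X]big_seq; apply: leq_sum => w.
rewrite rem_filter // mem_filter /= => /andP [nw wV].
move: (eq_l w wV) un; rewrite (negbTE nw) /underfull; case: eqP => [-> | _]; clear; lia.
Qed.

Lemma balance_spec F :
  splits (refine V A F) -> excess (refine V A F) <= size V * (size V).+1 ->
  let F' := balance V A cap F in
  splits F' /\ starts V cap F' (search V cap F') = [::].
Proof.
move=> sF le_e; rewrite /balance foldl_const.
have -> : size (flatten [seq 0 :: V | _ <- V]) = size V * (size V).+1.
  rewrite size_flatten /shape -map_comp sumnE big_map big_const_seq count_predT.
  by rewrite iter_addn_0 mulnC.
have h F' : splits F' -> splits (augment V A cap F') /\
    (augment V A cap F' = F' \/ excess (augment V A cap F') < excess F').
  by case/augment_spec => s1 [[_ ?]|?]; split=> //; [left|right].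
have [sF' fixed] := iter_stable h sF le_e; split=> //.
(* At a fixed point of [augment] the excess cannot have dropped, so there was nowhere to start. *)
by have [_ [[]|]] := augment_spec sF'; rewrite // fixed ltnn.
Qed.

Lemma ltn_sum_seq (P : pred nat) (f g : nat -> nat) s :
  (forall u, u \in V -> P u -> f u <= g u) -> s \in V -> P s -> f s < g s ->
  \sum_(u <- V | P u) f u < \sum_(u <- V | P u) g u.
Proof.
move=> le_fg sV Ps lt_s; rewrite (big_rem s) // [X in _ < X](big_rem s) //= Ps -addSn.
apply: leq_add => //; rewrite big_seq_cond [X in _ <= X]big_seq_cond.
by apply: leq_sum => u /andP [/mem_rem uV Pu]; apply: le_fg.
Qed.

(** The right-hand side runs over ordered pairs and counts every edge twice; hence the factor 2. *)
Definition violated (S : seq nat) : Prop :=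
  2 * \sum_(u <- V | u \in S) get1 cap u <
  \sum_(u <- V | u \in S) \sum_(v <- V | v \in S) get2 A u v.

Definition feasible F : Prop := splits F /\ forall u, u \in V -> load V F u <= get1 cap u.

(** The cut argument of max-flow min-cut. No vertex of S can pass a unit to a vertex outside S, so
    the loads in S add up to the demand of the edges inside S. Every vertex of S is full, and [s] is
    overfull, so this demand exceeds the capacity of S. *)
Lemma stuck_spec F (S := stuck V cap F) :
  splits F -> starts V cap F (search V cap F) = [::] ->
  if nilp S then feasible F else violated S.
Proof.
move=> sF no_start; rewrite /S /stuck; case: hasP => [[s sV ov] | no_over]; last first.
  by split=> // u uV; rewrite leqNgt; apply/negP => ov; apply: no_over; exists u.
have [_ closed] := search_spec F; set l := search V cap F in closed no_start *.
have ks : ~~ key l s.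
  apply/negP => ks; have : s \in starts V cap F l by rewrite mem_filter ov ks.
  by rewrite no_start.
have sS : s \in [seq u <- V | ~~ key l u] by rewrite mem_filter ks.
case: ifP => [/nilP eq0 | _]; first by rewrite eq0 in sS.
pose K u := ~~ key l u.
have inS (f : nat -> nat) :
    \sum_(u <- V | u \in [seq u <- V | ~~ key l u]) f u = \sum_(u <- V | K u) f u.
  rewrite big_seq_cond [RHS]big_seq_cond; apply: eq_bigl => u.
  by rewrite mem_filter; case: (u \in V); rewrite ?andbT.
rewrite /violated !inS.
under [X in _ < X]eq_bigr do rewrite inS.
have eq_load : \sum_(u <- V | K u) load V F u = \sum_(u <- V | K u) \sum_(v <- V | K v) get2 F u v.
  rewrite big_seq_cond [RHS]big_seq_cond; apply: eq_bigr => u /andP [uV Ku].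
  rewrite loadE [RHS]big_mkcond big_seq [RHS]big_seq; apply: eq_bigr => v vV.
  case: ifP => // /negbFE kv; apply/eqP; rewrite -leqn0 leqNgt; apply/negP => Fuv.
  by move: Ku; rewrite /K (closed u v).
have -> : \sum_(u <- V | K u) \sum_(v <- V | K v) get2 A u v =
    2 * \sum_(u <- V | K u) load V F u.
  rewrite mul2n -addnn {1}eq_load eq_load [X in _ = _ + X]exchange_big -big_split /=.
  rewrite big_seq_cond [RHS]big_seq_cond; apply: eq_bigr => u /andP [uV Ku].
  rewrite -big_split /= big_seq_cond [RHS]big_seq_cond; apply: eq_bigr => v /andP [vV Kv].
  by rewrite sF.
rewrite ltn_pmul2l //; apply: (ltn_sum_seq (s := s)) => // u uV Ku.
by rewrite leqNgt; apply: contra Ku; apply: key_search.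
Qed.

(** Origin of the bound: at each vertex, twice a capacity rounded up exceeds the original by at most
    1, and the odd units add at most one for each of the n vertices v. This gives n + 1 per
    vertex. *)
Lemma refine_spec F A' cap' :
  (forall i j, i \in V -> j \in V -> get2 F i j + get2 F j i = get2 A' i j) ->
  (forall i j, i \in V -> j \in V -> get2 A' i j = (get2 A i j)./2) ->
  (forall u, u \in V -> load V F u <= get1 cap' u) ->
  (forall u, u \in V -> get1 cap' u <= (get1 cap u + 1)./2) ->
  splits (refine V A F) /\ excess (refine V A F) <= size V * (size V).+1.
Proof.
move=> sF hA lF hc.
pose f i j := get2 F i j + get2 F i j + (if i < j then (if odd (get2 A i j) then 1 else 0) else 0).
have f_sum i j : i \in V -> j \in V -> f i j + f j i = get2 A i j.
  move=> iV jV; rewrite /f [get2 A j i]A_sym //.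
  have := sF i j iV jV; rewrite hA //; have := odd_double_half (get2 A i j).
  case: (ltngtP i j) => [||eq_ij]; [by case: odd => /=; lia| by case: odd => /=; lia|].
  by rewrite eq_ij A_diag /=; lia.
have fE i j : i \in V -> j \in V -> get2 (refine V A F) i j = f i j.
  (* By [f_sum], [f i j] is at most [get2 A i j], so the cap is inactive. *)
  by move=> iV jV; rewrite get2_clamp // -/(f i j); have := f_sum i j iV jV; lia.
split=> [i j iV jV|]; first by rewrite !fE // f_sum.
rewrite /excess; apply: (@leq_trans (\sum_(u <- V) (size V).+1)); last first.
  by rewrite big_const_seq count_predT iter_addn_0 mulnC.
rewrite big_seq [X in _ <= X]big_seq; apply: leq_sum => u uV.
have : load V (refine V A F) u <= 2 * load V F u + size V.
  rewrite !loadE -sum1_size big_distrr -big_split /= big_seq [X in _ <= X]big_seq.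
  apply: leq_sum => v vV; rewrite fE // /f.
  by case: ifP => _; [case: ifP => _|]; lia.
move: (lF u uV) (hc u uV); clear; lia.
Qed.

End Flow.

(** * Bit scaling *)

Section Scaling.

Variables (V : seq nat) (A : seq (nat * nat * nat)) (cap : seq (nat * nat)).
Hypothesis uniq_V : uniq V.
Hypothesis A_diag : forall i, get2 A i i = 0.
Hypothesis A_sym : forall i j, i \in V -> j \in V -> get2 A i j = get2 A j i.

Let level k := iter k (halve V A cap) (A, cap).

Lemma level_le2 k i j : i \in V -> j \in V -> get2 (level k).1 i j <= get2 A i j.
Proof. by case: k => //= k iV jV; rewrite get2_clamp // geq_minl. Qed.

Lemma level_le1 k u : u \in V -> get1 (level k).2 u <= get1 cap u.
Proof. by case: k => //= k uV; rewrite get1_tab uV geq_minl. Qed.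

Lemma level_half k i j : i \in V -> j \in V ->
  get2 (level k.+1).1 i j = (get2 (level k).1 i j)./2.
Proof.
move=> iV jV; rewrite /= get2_clamp //; apply/minn_idPr.
by have := level_le2 k iV jV; rewrite -/(level k); lia.
Qed.

Lemma level_cap k u : u \in V ->
  get1 (level k.+1).2 u <= (get1 (level k).2 u + 1)./2 /\
  get1 (level k).2 u <= 2 * get1 (level k.+1).2 u.
Proof.
move=> uV; rewrite /= get1_tab uV -/(level k).
by have := level_le1 k uV; move: (get1 _ u) (get1 _ u) => a b; clear; lia.
Qed.

Lemma level_diag k i : get2 (level k).1 i i = 0.
Proof.
case: k => [|k] //=; rewrite get2_tab A_diag min0n.
by case: ifP.
Qed.

Lemma level_sym k i j : i \in V -> j \in V -> get2 (level k).1 i j = get2 (level k).1 j i.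
Proof.
by move=> iV jV; elim: k => [|k IH]; [exact: A_sym | rewrite !level_half // IH].
Qed.

(** Doubling the rounded data gives capacities at least, and demands at most, those of the level
    below, so a strict violation survives the descent to level 0. *)
Lemma violated_level k S :
  violated V (level k).1 (level k).2 S -> violated V A cap S.
Proof.
elim: k => //= k IH; rewrite -/(level k.+1) => vk; apply: IH; move: vk; rewrite /violated.
set s := \sum_(u <- V | _) get1 (level k.+1).2 u.
set t := \sum_(u <- V | _) _ => lt_st.
have le1 : \sum_(u <- V | u \in S) get1 (level k).2 u <= 2 * s.
  rewrite big_distrr /= big_seq_cond [X in _ <= X]big_seq_cond.
  by apply: leq_sum => u /andP [uV _]; have [] := level_cap k uV.
have le2 : 2 * t <= \sum_(u <- V | u \in S) \sum_(v <- V | v \in S) get2 (level k).1 u v.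
  rewrite /t big_distrr /= big_seq_cond [X in _ <= X]big_seq_cond.
  apply: leq_sum => u /andP [uV _]; rewrite big_distrr /=.
  rewrite big_seq_cond [X in _ <= X]big_seq_cond.
  apply: leq_sum => v /andP [vV _]; rewrite -/(level k.+1) level_half //.
  by clear; lia.
by move: lt_st le1 le2; clear; lia.
Qed.

(** A split is feasible only for its own level, whereas a violating set is final and refers to the
    original data. *)
Let progress k (st : seq nat * mat) : Prop :=
  if nilp st.1 then feasible V (level k).1 (level k).2 st.2 else violated V A cap st.1.

Lemma phase_spec k st : progress k.+1 st -> progress k (phase V st (level k)).
Proof.
rewrite /progress /phase; case: ifP => [_ [sF lF] | -> //].
have [s1 e1] : splits V (level k).1 (refine V (level k).1 st.2) /\
    excess V (level k).2 (refine V (level k).1 st.2) <= size V * (size V).+1.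
  apply: (@refine_spec _ _ _ _ _ _ _ (level k.+1).1 (level k.+1).2) => //.
  - exact: level_diag.
  - by move=> i j; apply: level_sym.
  - by move=> i j; apply: level_half.
  - by move=> u uV; have [] := level_cap k uV.
have [s2 n2] := balance_spec uniq_V (level_diag k) s1 e1.
have /= := stuck_spec uniq_V s2 n2.
by case: ifP => // _; apply: violated_level.
Qed.

Lemma solve_spec fuel :
  (forall i j, i \in V -> j \in V -> get2 A i j < 2 ^ size fuel) ->
  let S := solve V A cap fuel in
  if nilp S then exists F, feasible V A cap F else violated V A cap S.
Proof.
move=> lt_A; rewrite /solve.
pose fix Ls m := if m is m'.+1 then level m :: Ls m' else [:: level 0].
have -> : levels V A cap fuel = Ls (size fuel).
  rewrite /levels foldl_const.
  have -> : [:: (A, cap)] = Ls 0 by [].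
  elim: {fuel lt_A}(size fuel) => //= m ->.
  by congr (_ :: _); case: m.
(* One level beyond the coarsest one all demands have been halved to 0, so the empty table is a
   feasible split. *)
have start : progress (size fuel).+1 ([::], [::]).
  split=> [i j iV jV | u uV]; last first.
    by rewrite loadE big1 // => v; rewrite /get2.
  suff -> : get2 (level (size fuel).+1).1 i j = 0 by [].
  rewrite level_half //; move: (lt_A i j iV jV).
  have le_pow k : get2 (level k).1 i j * 2 ^ k <= get2 A i j.
    elim: k => [|k IH]; first by rewrite muln1.
    rewrite level_half // expnS; move: IH; set x := get2 (level k).1 i j.
    by have := odd_double_half x; move: (2 ^ k) => y; clear; nia.
  have := le_pow (size fuel); have := expn_gt0 2 (size fuel).
  by move: (2 ^ _) (get2 (level _).1 i j) (get2 A i j) => a b c; clear; nia.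
have : progress 0 (foldl (phase V) ([::], [::]) (Ls (size fuel))).
  elim: (size fuel) ([::], [::]) start => [|m IH] st pst /=; first exact: phase_spec.
  by apply: IH; apply: phase_spec.
rewrite /progress; case: ifP => // _ ?; by exists (foldl (phase V) ([::], [::]) (Ls (size fuel))).2.
Qed.

End Scaling.

Import Order.TTheory GRing.Theory Num.Theory.
Local Open Scope ring_scope.

(** * Density inequalities in terms of flows *)

Lemma set2_inj (T : finType) (i j k l : T) :
  [set i; j] = [set k; l] -> i = k /\ j = l \/ i = l /\ j = k.
Proof.
move=> eq_s.
have : i \in [set k; l] by rewrite -eq_s set21.
have : j \in [set k; l] by rewrite -eq_s set22.
have : k \in [set i; j] by rewrite eq_s set21.
have : l \in [set i; j] by rewrite eq_s set22.
rewrite !inE => /orP [] /eqP ? /orP [] /eqP ? /orP [] /eqP ? /orP [] /eqP ?; subst;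
  by [left | right].
Qed.

Section Density.

Variables (T : finType) (R : realFieldType).
Implicit Types (F E : {set {set T}}) (x w : {ffun T -> R}).

Lemma incidence_sum F (g : T -> {set T} -> R) :
  \sum_(e in F) \sum_(i in e) g i e = \sum_i \sum_(e in F | i \in e) g i e.
Proof. by rewrite (exchange_big_dep predT). Qed.

Lemma star_sum F (i : T) (h : {set T} -> R) : simple_graph F ->
  \sum_(e in F | i \in e) h e = \sum_(j | [set i; j] \in F) h [set i; j].
Proof.
move=> simF.
have -> : \sum_(e in F | i \in e) h e =
    \sum_(e in [set [set i; j] | j in [set j | [set i; j] \in F]]) h e.
  apply: eq_bigl => e; apply/andP/imsetP => [[eF ie] | [j]]; last first.
    by rewrite inE => eF ->; rewrite set21.
  have /eqP/cards2P [k [l [ne eq_e]]] := simF e eF.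
  move: ie eF; rewrite eq_e in_set2 => /orP [] /eqP -> eF; first by exists l; rewrite ?inE.
  by exists k; [rewrite inE setUC | rewrite setUC].
rewrite big_imset /=; first by apply: eq_bigl => j; rewrite inE.
move=> j k; rewrite !inE => jF kF /set2_inj [[_ //]|[eq_k eq_j]].
by rewrite eq_j -eq_k.
Qed.

(** Each edge is seen from both ends. This links sums over edge sets with tables indexed by ordered
    pairs. *)
Lemma edge_pair_sum F (h : {set T} -> R) : simple_graph F ->
  \sum_i \sum_(j | [set i; j] \in F) h [set i; j] = 2 * \sum_(e in F) h e.
Proof.
move=> simF; under eq_bigr => i _ do rewrite -star_sum //.
rewrite -(incidence_sum F (fun _ e => h e)) mulr_sumr; apply: eq_bigr => e eF.
by rewrite sumr_const (simF e eF) mulr_natl.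
Qed.

Lemma degree_sum F (y : T -> R) :
  \sum_(u in verts F) (deg F u)%:R * y u = \sum_(e in F) \sum_(u in e) y u.
Proof.
rewrite (incidence_sum F (fun u _ => y u)) [LHS]big_mkcond; apply: eq_bigr => u _.
rewrite sumr_const mulr_natl /deg; set m := #|_|; set k := #|_|.
have -> : k = m by apply: eq_card => e; rewrite !inE.
case: ifP => // /negP nu; suff -> : m = 0%N by [].
apply: eq_card0 => e; rewrite !inE; apply/negP => /andP [eF ue]; apply: nu.
by apply/bigcupP; exists e.
Qed.

(** By [degree_sum] the left-hand side is x(F) - x(V(F)), where x(F) sums x over the ends of all
    edges; since an edge has two ends, its term w(e) - 1 equals 1 - x(e). *)
Lemma density_ineqE F x : simple_graph F ->
  edge_density_ineq F x <->
  1 + \sum_(e in F) (\sum_(u in e) (1 - x u) - 1) <= \sum_(u in verts F) (1 - x u).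
Proof.
move=> simF; rewrite /edge_density_ineq.
have -> : \sum_(u in verts F) ((deg F u)%:R - 1) * x u =
    \sum_(e in F) \sum_(u in e) x u - \sum_(u in verts F) x u.
  rewrite -degree_sum -sumrB; apply: eq_bigr => u _; ring.
have -> : \sum_(e in F) (\sum_(u in e) (1 - x u) - 1) =
    #|F|%:R - \sum_(e in F) \sum_(u in e) x u.
  rewrite -sumr_const -sumrB; apply: eq_bigr => e eF.
  rewrite sumrB sumr_const (simF e eF); ring.
rewrite [X in _ <-> _ <= X]sumrB sumr_const.
by split; lra.
Qed.

End Density.

Section EdgeFlow.

Variables (T : finType) (R : realFieldType) (E : {set {set T}}) (x : {ffun T -> R}).
Variables (D : nat) (i0 j0 : T) (a : T -> T -> nat) (c : T -> nat).

Let w (i : T) : R := 1 - x i.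
Let e0 : {set T} := [set i0; j0].

Hypothesis simE : simple_graph E.
Hypothesis e0E : e0 \in E.
Hypothesis D_gt0 : (0 < D)%N.
Hypothesis w_ge0 : forall i, 0 <= w i.
Hypothesis c_val : forall i, (c i)%:R = if (i == i0) || (i == j0) then 0 else D%:R * w i.
Hypothesis a_sym : forall i j, a i j = a j i.
Hypothesis a_ge : forall i j, [set i; j] \in E -> [set i; j] != e0 ->
  D%:R * (w i + w j - 1) <= (a i j)%:R.
Hypothesis a_pos : forall i j, (0 < a i j)%N ->
  [/\ [set i; j] \in E, [set i; j] != e0 & (a i j)%:R = D%:R * (w i + w j - 1)].

Let ne_ij0 : i0 != j0.
Proof. by have := simE e0E; rewrite cards2; case: eqP. Qed.

Let edge_sum i j : i != j -> \sum_(u in [set i; j]) w u = w i + w j.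
Proof. by move=> ne; rewrite big_setU1 ?big_set1 // inE. Qed.

Let edge_neq (F : {set {set T}}) i j : simple_graph F -> [set i; j] \in F -> i != j.
Proof. by move=> simF /simF; rewrite cards2; case: eqP. Qed.

(** Isolates the weight of the ends of [e0], which cancels against the constant 1 plus the term of
    [e0]. *)
Let cover_sum (A : {set T}) : i0 \in A -> j0 \in A ->
  D%:R * \sum_(u in A) w u = D%:R * (w i0 + w j0) + \sum_(u in A) (c u)%:R.
Proof.
move=> iA jA; rewrite (bigD1 i0) //= (bigD1 j0) /=; last by rewrite jA eq_sym.
rewrite [X in _ = _ + X](bigD1 i0) //= [X in _ = _ + (_ + X)](bigD1 j0) /=; last first.
  by rewrite jA eq_sym.
have -> : \sum_(u | (u \in A) && (u != i0) && (u != j0)) (c u)%:R =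
    D%:R * \sum_(u | (u \in A) && (u != i0) && (u != j0)) w u.
  rewrite mulr_sumr; apply: eq_bigr => u /andP [/andP [_ n1] n2].
  by rewrite c_val (negbTE n1) (negbTE n2).
rewrite !c_val !eqxx orbT /=; ring.
Qed.

(** Weak duality: the demand of each edge of F' is paid by its two ends, which lie in [verts F] and
    pay at most their capacities in total. Truncation at 0 only raises demands, so the inequality
    [a_ge] suffices. *)
Lemma feasible_edge (f : T -> T -> nat) (F : {set {set T}}) :
  (forall i j, f i j + f j i = a i j)%N -> (forall i, \sum_j f i j <= c i)%N ->
  F \subset E -> e0 \in F -> edge_density_ineq F x.
Proof.
move=> f_split f_load sFE e0F.
have simF : simple_graph F by move=> e /(subsetP sFE)/simE.
pose F' := F :\ e0.
have simF' : simple_graph F' by move=> e; rewrite in_setD1 => /andP [_ /simF].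
apply/(density_ineqE _ simF).
have e0v : i0 \in verts F /\ j0 \in verts F.
  by split; apply/bigcupP; exists e0; rewrite // !inE eqxx ?orbT.
rewrite (big_setD1 e0) //= -/F' edge_sum //.
have D0 : 0 < D%:R :> R by rewrite ltr0n.
rewrite -(ler_pM2l D0) (cover_sum e0v.1 e0v.2) -subr_ge0.
suff : 2 * (D%:R * \sum_(e in F') (\sum_(u in e) w u - 1)) <= 2 * \sum_(u in verts F) (c u)%:R.
  by rewrite /w; lra.
rewrite mulrCA -(edge_pair_sum _ simF') mulr_sumr.
apply: (@le_trans _ _ (\sum_i \sum_(j | [set i; j] \in F') (a i j)%:R)).
  apply: ler_sum => i _; rewrite mulr_sumr; apply: ler_sum => j ijF'.
  rewrite edge_sum; last exact: edge_neq ijF'.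
  by move: ijF'; rewrite !inE => /andP [n0 /(subsetP sFE) ijE]; apply: a_ge.
have -> : \sum_i \sum_(j | [set i; j] \in F') (a i j)%:R =
    2 * \sum_i \sum_(j | [set i; j] \in F') (f i j)%:R :> R.
  rewrite mulr_natl mulr2n [X in _ = _ + X](exchange_big_dep predT) //= -big_split /=.
  apply: eq_bigr => i _; rewrite [X in _ = _ + X](eq_bigl (fun j => [set i; j] \in F')).
    by rewrite -big_split /=; apply: eq_bigr => j _; rewrite -natrD f_split.
  by move=> j; rewrite setUC.
rewrite ler_pM2l // [X in _ <= X]big_mkcond; apply: ler_sum => i _.
case: ifP => [_ | /negP ni].
  apply: (@le_trans _ _ (\sum_j (f i j)%:R)); last by rewrite -natr_sum ler_nat.
  by rewrite [X in _ <= X](bigID (fun j => [set i; j] \in F')) /= lerDl sumr_ge0.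
rewrite big1 // => j; rewrite !inE => /andP [_ ijF]; case: ni.
by apply/bigcupP; exists [set i; j]; rewrite ?set21.
Qed.

Section Violated.

Variable S : pred T.
Hypothesis S_violated :
  (2 * \sum_(u | S u) c u < \sum_(u | S u) \sum_(v | S v) a u v)%N.

(** Among the edges inside S, those of positive demand are the ones that push the inequality towards
    violation. [e0] is added because its ends were given capacity 0. *)
Definition witness_set : {set {set T}} :=
  e0 |: [set e in E | [exists i, exists j, (e == [set i; j]) && [&& S i, S j & 0 < a i j]%N]].

Lemma mem_witness_set i j :
  ([set i; j] \in witness_set) =
  [&& S i, S j & 0 < a i j]%N || ((i == i0) && (j == j0) || (i == j0) && (j == i0)).
Proof.
rewrite !inE orbC; congr (_ || _); last first.
  apply/eqP/orP => [/set2_inj [] [-> ->] | [] /andP [/eqP -> /eqP ->] //].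
  - by left; rewrite !eqxx.
  - by right; rewrite !eqxx.
  - by rewrite setUC.
apply/andP/and3P => [[_ /existsP [k /existsP [l /andP [/eqP /set2_inj]]]] | [Si Sj aij]].
  by case=> [] [-> ->] /and3P [? ? ?] //; split=> //; rewrite a_sym.
have [ijE _ _] := a_pos aij; split=> //; apply/existsP; exists i; apply/existsP; exists j.
by rewrite eqxx Si Sj.
Qed.

Lemma witness_set_sub : witness_set \subset E.
Proof. by apply/subsetP => e; rewrite !inE => /orP [/eqP -> // | /andP []]. Qed.

Lemma violated_edge : ~ edge_density_ineq witness_set x.
Proof.
set F := witness_set.
have simF : simple_graph F by move=> e /(subsetP witness_set_sub)/simE.
pose F' := F :\ e0.
have simF' : simple_graph F' by move=> e; rewrite in_setD1 => /andP [_ /simF].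
have e0F : e0 \in F by rewrite !inE eqxx.
move/(density_ineqE _ simF); apply/negP; rewrite -ltNge.
have D0 : 0 < D%:R :> R by rewrite ltr0n.
(* Some vertices of S may lie on no chosen edge; as [w] is nonnegative, counting them too only
   enlarges the side to be exceeded. *)
pose A := [set u | S u] :|: e0.
have le_A : \sum_(u in verts F) w u <= \sum_(u in A) w u.
  rewrite [X in _ <= X](bigID (mem (verts F))) /=.
  rewrite (eq_bigl (fun u => (u \in A) && (u \in verts F))) ?lerDl ?sumr_ge0 //.
  move=> u; case: (boolP (u \in verts F)); rewrite ?andbF // => /bigcupP [e eF ue].
  have : e0 \subset A by rewrite subsetUr.
  move: eF ue; rewrite 2!inE => /orP [/eqP -> ue /subsetP/(_ _ ue) -> // |].
  rewrite inE => /andP [_ /existsP [k /existsP [l /andP [/eqP -> /and3P [Sk Sl _]]]]].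
  by rewrite !inE => /orP [] /eqP -> _; rewrite ?Sk ?Sl.
apply: le_lt_trans le_A _; rewrite (big_setD1 e0) //= -/F' edge_sum //.
rewrite -(ltr_pM2l D0) cover_sum; last 2 first.
- by rewrite !inE eqxx orbT.
- by rewrite !inE eqxx !orbT.
suff : 2 * \sum_(u in A) (c u)%:R < 2 * (D%:R * \sum_(e in F') (\sum_(u in e) w u - 1)).
  by rewrite /w; lra.
rewrite mulrCA -(edge_pair_sum _ simF') [X in _ < X]mulr_sumr.
(* The ends of [e0] have capacity 0, so adding them to S changes nothing. *)
have -> : \sum_(u in A) (c u)%:R = \sum_(u | S u) (c u)%:R :> R.
  rewrite big_mkcond [RHS]big_mkcond; apply: eq_bigr => u _; rewrite !inE.
  by case: (S u) => //=; case: ifP => // h; rewrite c_val h.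
have -> : \sum_i D%:R * \sum_(j | [set i; j] \in F') (\sum_(u in [set i; j]) w u - 1) =
    (\sum_(u | S u) \sum_(v | S v) a u v)%:R.
  rewrite natr_sum [RHS]big_mkcond; apply: eq_bigr => i _.
  rewrite mulr_sumr big_mkcond /= natr_sum.
  rewrite (_ : (if S i then _ else _) = \sum_j (if S i && S j then (a i j)%:R else 0)); last first.
    by case: ifP => _; [rewrite big_mkcond | rewrite big1].
  apply: eq_bigr => j _; rewrite in_setD1 mem_witness_set.
  (* A pair of demand 0 can enter the witness only as [e0], which F' leaves out. *)
  case: (posnP (a i j)) => [a0 | a_gt]; last first.
    have [ijE n0 eq_a] := a_pos a_gt; rewrite n0 andbT /=.
    have -> : (i == i0) && (j == j0) || (i == j0) && (j == i0) = false.
      by apply: contraNF n0 => /orP [] /andP [/eqP -> /eqP ->]; rewrite // setUC.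
    rewrite orbF; case: ifP => // _; rewrite edge_sum ?eq_a //.
    exact: edge_neq ijE.
  rewrite !andbF /=; case: ifP => [/andP [n0 h] | _]; last by case: ifP => _; rewrite ?a0.
  case/negP: n0; apply/eqP; case/orP: h => /andP [/eqP -> /eqP ->] //.
  by rewrite setUC.
by rewrite -natr_sum -natrM ltr_nat.
Qed.

End Violated.

End EdgeFlow.

(** * Correctness of the algorithm *)

Lemma enumerate_ord n A (g : 'I_n -> A) :
  enumerate [seq g i | i <- enum 'I_n] = [seq (val i, g i) | i <- enum 'I_n].
Proof. by rewrite /enumerate size_map size_enum_ord -val_enum_ord zip_map. Qed.

Lemma tree_of_seq_map S T (g : S -> T) (f : T -> tree) (s : seq S) :
  tree_of_seq f (map g s) = tree_of_seq (fun a => f (g a)) s.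
Proof. by elim: s => //= a s ->. Qed.

Lemma eq_tree_of_seq T (f g : T -> tree) (s : seq T) :
  f =1 g -> tree_of_seq f s = tree_of_seq g s.
Proof. by move=> fg; elim: s => //= a s ->; rewrite fg. Qed.

Lemma foldl_first (A : eqType) B (g : A -> seq B) (s : seq A) :
  let r := foldl (fun acc e => if nilp acc then g e else acc) [::] s in
  r = [::] /\ (forall e, e \in s -> g e = [::]) \/
  exists e, [/\ e \in s, r = g e & ~~ nilp (g e)].
Proof.
elim/last_ind: s => [|s a IH] /=; first by left.
rewrite foldl_rcons; case: IH => [[-> all_nil] | [e [es -> ne]]] /=.
  case: (boolP (nilp (g a))) => [/nilP ga | ne]; [left | right].
    split=> // e; rewrite mem_rcons inE => /orP [/eqP -> // |]; exact: all_nil.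
  by exists a; rewrite mem_rcons mem_head.
by right; exists e; rewrite (negbTE ne) mem_rcons inE es orbT.
Qed.

Lemma get2_le_sum (m : mat) u v : (get2 m u v <= sumn [seq p.2 | p <- m])%N.
Proof. by elim: m => //= p m IH; case: ifP => _; lia. Qed.

Lemma rat_ge0_frac (q : rat) : 0 <= q -> q = `|numq q|%N%:R / `|denq q|%N%:R.
Proof.
move=> q0; rewrite -[LHS]divq_num_den; congr (_ / _).
  by rewrite -{1}[numq q]gez0_abs ?numq_ge0 // -pmulrn.
by rewrite -{1}[denq q]gez0_abs ?denq_ge0 // -pmulrn.
Qed.

Section Instance.

Variables (n : nat) (E : {set {set 'I_n}}) (x : {ffun 'I_n -> rat}).
Hypothesis simE : simple_graph E.

Definition instance_of : instance :=
  ([seq [seq [set i; j] \in E | j <- enum 'I_n] | i <- enum 'I_n],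
   [seq (numq (x i) < 0, `|numq (x i)|%N, `|denq (x i)|%N) | i <- enum 'I_n]).

Local Notation I := instance_of.

Lemma word_instance : word I = encode_instance E x.
Proof.
congr preorder; congr Node; rewrite /code /coded_seq tree_of_seq_map //.
by apply: eq_tree_of_seq => i; apply: tree_of_seq_map.
Qed.

Lemma vertices_instance : vertices I = iota 0 n.
Proof. by rewrite /vertices enumerate_ord -map_comp -val_enum_ord. Qed.

Lemma mem_vertices (i : 'I_n) : val i \in vertices I.
Proof. by rewrite vertices_instance mem_iota /= ltn_ord. Qed.

Lemma vertices_val v : v \in vertices I -> exists i : 'I_n, v = val i.
Proof. by rewrite vertices_instance mem_iota /= => lt_v; exists (Ordinal lt_v). Qed.

Lemma big_vertices (R : Type) (idx : R) (op : Monoid.law idx) (P : pred nat) (F : nat -> R) :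
  \big[op/idx]_(v <- vertices I | P v) F v = \big[op/idx]_(i < n | P i) F i.
Proof. by rewrite vertices_instance -[n in iota _ n]subn0 big_mkord. Qed.

Lemma adjacency_instance :
  adjacency I = [seq (val i, val j, if [set i; j] \in E then 1%N else 0%N)
                | i <- enum 'I_n, j <- enum 'I_n].
Proof.
rewrite /adjacency enumerate_ord; congr flatten; rewrite -map_comp.
by apply: eq_map => i /=; rewrite enumerate_ord -map_comp.
Qed.

Lemma get_adjacency (i j : 'I_n) :
  get2 (adjacency I) (val i) (val j) = ([set i; j] \in E).
Proof.
rewrite adjacency_instance (get2_map _ _ _ _ _ val_inj) !mem_enum /=.
by case: (_ \in _).
Qed.

Lemma get_signs (i : 'I_n) : get1 (signs I) (val i) = (x i < 0).
Proof.
rewrite /signs enumerate_ord -map_comp (get1_map _ _ _ val_inj) mem_enum /=.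
by rewrite numq_lt0; case: (_ < _).
Qed.

Lemma get_nums (i : 'I_n) : get1 (nums I) (val i) = `|numq (x i)|%N.
Proof. by rewrite /nums enumerate_ord -map_comp (get1_map _ _ _ val_inj) mem_enum. Qed.

Lemma get_dens (i : 'I_n) : get1 (dens I) (val i) = `|denq (x i)|%N.
Proof. by rewrite /dens enumerate_ord -map_comp (get1_map _ _ _ val_inj) mem_enum. Qed.

Lemma den_gt0 (i : 'I_n) : (0 < `|denq (x i)|)%N.
Proof. by rewrite absz_gt0 denq_neq0. Qed.

Lemma scaleE : scale I = (\prod_(i < n) `|denq (x i)|)%N.
Proof.
rewrite /scale foldrE big_map big_vertices; apply: eq_bigr => i _; exact: get_dens.
Qed.

Lemma scale_gt0 : (0 < scale I)%N.
Proof. by rewrite scaleE prodn_gt0 // => i; apply: den_gt0. Qed.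

Lemma weightE (i : 'I_n) : 0 <= x i <= 1 ->
  (weight I (val i))%:R = (scale I)%:R * (1 - x i) :> rat.
Proof.
move=> /andP [x0 x1]; rewrite /weight get_dens get_nums foldrE big_map big_filter big_vertices.
have -> : (\prod_(j < n | ~~ (val j == val i)) get1 (dens I) j =
    \prod_(j < n | j != i) `|denq (x j)|)%N.
  by apply: eq_big => j; [rewrite val_eqE | rewrite -get_dens].
rewrite scaleE [in RHS](bigD1 i) //=; set p := (\prod_(j < n | j != i) `|denq (x j)|)%N.
have d0 : 0 < `|denq (x i)|%N%:R :> rat by rewrite ltr0n den_gt0.
have eq_x := rat_ge0_frac x0.
have le_md : (`|numq (x i)| <= `|denq (x i)|)%N.
  by move: x1; rewrite {1}eq_x ler_pdivrMr // mul1r ler_nat.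
have -> : 1 - x i = 1 - `|numq (x i)|%N%:R / `|denq (x i)|%N%:R by rewrite {1}eq_x.
rewrite !natrM natrB //; field.
by rewrite lt0r_neq0.
Qed.

Lemma get_demand (i j : 'I_n) :
  get2 (demand I) (val i) (val j) =
  if [set i; j] \in E then (weight I (val i) + weight I (val j) - scale I)%N else 0%N.
Proof. by rewrite /demand get2_tab !mem_vertices /= get_adjacency; case: (_ \in _). Qed.

Lemma edge_listP (e : nat * nat) : e \in edge_list I ->
  exists i j : 'I_n, e = (val i, val j) /\ [set i; j] \in E.
Proof.
rewrite /edge_list adjacency_instance => /mapP [p]; rewrite mem_filter => /andP [+ /allpairsP].
move=> + [[i j] /= [_ _ eq_p]]; rewrite eq_p /= => lt0 ->; exists i, j; split=> //.
by move: lt0; case: ifP.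
Qed.

Lemma mem_edge_list (i j : 'I_n) : [set i; j] \in E -> (val i, val j) \in edge_list I.
Proof.
move=> ijE; apply/mapP; exists (val i, val j, 1%N) => //; rewrite mem_filter /=.
rewrite adjacency_instance; apply/allpairsP; exists (i, j); rewrite !mem_enum ijE.
by split.
Qed.

Section Edge.

Variables (i0 j0 : 'I_n).
Hypothesis e0E : [set i0; j0] \in E.
Hypothesis x_bounds : forall i, 0 <= x i <= 1.

Let e := (val i0, val j0).
Let a (i j : 'I_n) := get2 (demand_off I e) (val i) (val j).
Let c (i : 'I_n) := get1 (capacity I e) (val i).

Lemma edge_pair_eq (i j : 'I_n) : ([set i; j] == [set i0; j0]) =
  ((val i == e.1) && (val j == e.2) || (val i == e.2) && (val j == e.1)).
Proof.
rewrite /= !val_eqE; apply/eqP/orP => [/set2_inj [] [-> ->] | [] /andP [/eqP -> /eqP ->] //].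
- by left; rewrite !eqxx.
- by right; rewrite !eqxx.
- by rewrite setUC.
Qed.

Lemma get_demand_off i j : a i j =
  if ([set i; j] \in E) && ([set i; j] != [set i0; j0])
  then (weight I (val i) + weight I (val j) - scale I)%N else 0%N.
Proof.
rewrite /a /demand_off get2_tab !mem_vertices /= get_demand edge_pair_eq.
by case: ifP => _; rewrite ?andbF ?andbT.
Qed.

Lemma get_capacity i : (c i)%:R =
  if (i == i0) || (i == j0) then 0 else (scale I)%:R * (1 - x i) :> rat.
Proof.
rewrite /c /capacity get1_tab mem_vertices /= !val_eqE.
by case: ifP => // _; apply: weightE.
Qed.

Lemma demand_off_sym i j : a i j = a j i.
Proof. by rewrite !get_demand_off setUC addnC. Qed.

Lemma demand_off_ge i j : [set i; j] \in E -> [set i; j] != [set i0; j0] ->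
  (scale I)%:R * (1 - x i + (1 - x j) - 1) <= (a i j)%:R.
Proof.
move=> ijE ne; rewrite get_demand_off ijE ne /=.
have := weightE (x_bounds i); have := weightE (x_bounds j).
set u := weight I _; set v := weight I _ => eq_u eq_v.
have : (v + u)%:R <= (v + u - scale I + scale I)%:R :> rat by rewrite ler_nat; lia.
rewrite !natrD eq_u eq_v; lra.
Qed.

Lemma demand_off_pos i j : (0 < a i j)%N ->
  [/\ [set i; j] \in E, [set i; j] != [set i0; j0] &
     (a i j)%:R = (scale I)%:R * (1 - x i + (1 - x j) - 1)].
Proof.
rewrite get_demand_off; case: ifP => // /andP [ijE ne] lt0; split=> //.
have := weightE (x_bounds i); have := weightE (x_bounds j).
set u := weight I _ in lt0 *; set v := weight I _ in lt0 * => eq_u eq_v.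
rewrite natrB; last by move: lt0; lia.
rewrite natrD eq_u eq_v; ring.
Qed.

Lemma solve_edge_spec :
  if nilp (solve_edge I e) then exists F, feasible (vertices I) (demand_off I e) (capacity I e) F
  else violated (vertices I) (demand_off I e) (capacity I e) (solve_edge I e).
Proof.
apply: (@solve_spec (vertices I) (demand_off I e) (capacity I e)).
- by rewrite vertices_instance iota_uniq.
- move=> i; rewrite /demand_off get2_tab andbb; case: ifP => // /vertices_val [k ->].
  have := get_demand_off k k; rewrite /a /demand_off get2_tab mem_vertices /= => ->.
  by case: ifP => // /andP [/simE]; rewrite setUid cards1.
- by move=> i j /vertices_val [k ->] /vertices_val [l ->]; apply: demand_off_sym.
move=> i j iV jV; apply: leq_ltn_trans (lt_exp_blen _).
apply: leq_trans (get2_le_sum _ i j).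
by rewrite /demand_off get2_tab iV jV /=; case: ifP.
Qed.

Lemma solve_edge_nil (F : {set {set 'I_n}}) :
  nilp (solve_edge I e) -> F \subset E -> [set i0; j0] \in F ->
  edge_density_ineq F x.
Proof.
move=> nil_S sFE e0F; have := solve_edge_spec; rewrite nil_S => -[f [f_split f_load]].
apply: (@feasible_edge _ _ E x (scale I) i0 j0 a c simE e0E scale_gt0 get_capacity
  demand_off_ge (fun i j => get2 f (val i) (val j))) => // [i j | i].
- by apply: f_split; apply: mem_vertices.
- by have := f_load (val i) (mem_vertices i); rewrite loadE big_vertices.
Qed.

Lemma solve_edge_witness (S := solve_edge I e) (F := witness_set E i0 j0 a (fun i => val i \in S)) :
  ~~ nilp S ->
  [/\ F != set0, F \subset E, ~ edge_density_ineq F x &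
      tree_of_edges F = code (witness I e S)].
Proof.
move=> nn; have := solve_edge_spec; rewrite (negbTE nn) /violated.
rewrite !big_vertices; under [X in (_ < X)%N]eq_bigr do rewrite big_vertices.
move=> viol; split.
- by apply/set0Pn; exists [set i0; j0]; rewrite !inE eqxx.
- exact: witness_set_sub.
- apply: (@violated_edge _ _ E x (scale I) i0 j0 a c) => //.
  + exact: scale_gt0.
  + by move=> i; have /andP [_] := x_bounds i; rewrite subr_ge0.
  + exact: get_capacity.
  + exact: demand_off_sym.
  + exact: demand_off_pos.
rewrite /witness vertices_instance -val_enum_ord /tree_of_edges.
rewrite /code /coded_seq -map_comp tree_of_seq_map; apply: eq_tree_of_seq => i /=.
rewrite -map_comp /code /coded_seq [RHS]tree_of_seq_map; apply: eq_tree_of_seq => j /=.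
congr tree_of_bool.
rewrite (mem_witness_set demand_off_sym demand_off_pos) !has_pred1 !val_eqE.
by rewrite andbA.
Qed.

End Edge.

Lemma answer_spec :
  exists a : option (inequality 'I_n),
    word (answer I) = encode_answer a /\ correct_answer E x a.
Proof.
have get_head (s : seq nat) : ~~ nilp s -> head 0%N s \in s by case: s => // a s _; apply: mem_head.
rewrite /answer; case: ifP => [/get_head | /negbFE/nilP no_neg].
  rewrite mem_filter => /andP [+ /vertices_val [u eq_u]]; rewrite eq_u get_signs => neg.
  exists (Some (LowerBound u)); split=> //=; split=> //.
  by move: neg; case: (ltP (x u) 0) => // ? _; apply/negP; rewrite -ltNge.
have x0 i : 0 <= x i.
  rewrite leNgt; apply/negP => neg; have : val i \in negatives I.
    by rewrite mem_filter get_signs neg mem_vertices.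
  by rewrite no_neg.
case: ifP => [/get_head | /negbFE/nilP no_exc].
  rewrite mem_filter => /andP [+ /vertices_val [u eq_u]].
  rewrite eq_u get_dens get_nums => exc.
  exists (Some (UpperBound u)); split=> //=; split=> //; apply/negP; rewrite -ltNge.
  by rewrite (rat_ge0_frac (x0 u)) ltr_pdivlMr ?ltr0n ?den_gt0 // mul1r ltr_nat.
have x_bounds i : 0 <= x i <= 1.
  rewrite x0 /= leNgt; apply/negP => exc; have : val i \in exceeding I.
    rewrite mem_filter get_dens get_nums mem_vertices andbT.
    move: exc; rewrite {1}(rat_ge0_frac (x0 i)) ltr_pdivlMr ?ltr0n ?den_gt0 //.
    by rewrite mul1r ltr_nat.
  by rewrite no_exc.
pose g e := if nilp (solve_edge I e) then [::] else witness I e (solve_edge I e).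
have : violation I = foldl (fun acc e => if nilp acc then g e else acc) [::] (edge_list I) by [].
case: (foldl_first g (edge_list I)) => [[-> no_viol] -> | [e [eI -> nw] ->]].
  (* A nonempty F contains some edge, and the run in which this edge plays the role of [e0] covers
     F. *)
  exists None; split=> //=; split=> // F /set0Pn [f fF] sFE.
  have /eqP/cards2P [i [j [ne eq_f]]] := simE (subsetP sFE f fF).
  rewrite eq_f in fF; have ijE := subsetP sFE _ fF.
  apply: (solve_edge_nil ijE x_bounds _ sFE fF).
  (* [g] could also be empty because a witness has no rows, that is for n = 0; the vertex [i]
     excludes this. *)
  have := no_viol _ (mem_edge_list ijE); rewrite /g; case: ifP => // _ /(congr1 size).
  rewrite size_map => /size0nil eq0; have := mem_vertices i.
  by rewrite eq0.
have [i [j [eq_e ijE]]] := edge_listP eI.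
rewrite (negbTE nw); move: nw; rewrite /g; case: ifP => // nn _; rewrite eq_e in nn *.
have [F0 sFE viol eq_tree] := solve_edge_witness ijE x_bounds (negbT nn).
set F := witness_set _ _ _ _ _ in F0 sFE viol eq_tree.
by exists (Some (EdgeDensity F)); split; first by rewrite /encode_answer eq_tree.
Qed.

End Instance.

Theorem mainTheorem4 :
  exists (M : turing_machine) (p : {poly nat}),
    forall (n : nat) (E : {set {set 'I_n}}) (x : {ffun 'I_n -> rat}),
      simple_graph E ->
      exists a : option (inequality 'I_n),
        computes_within M p.[size (encode_instance E x)]
          (encode_instance E x) (encode_answer a) /\
        correct_answer E x a.
Proof.
have [c [g [k le_g] run_c]] := ptime_answer.
exists (machine (compile 0 c)), (('X + 2%:R%:P) ^+ k) => n E x simE.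
have [a [eq_a correct]] := answer_spec x simE; exists a; split=> //.
have [t le_t run_t] := run_c (instance_of E x) [::] [::] [::] [::].
rewrite !cats0 eq_a word_instance in run_t.
apply: (compiled_computes run_t) => //; apply: leq_trans le_t (leq_trans (le_g _) _).
rewrite /sz word_instance horner_exp hornerD hornerX hornerC.
exact: leqnn.
Qed.
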